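(* Let $Q$ be a quiver and let $\mathbf{d} \in \mathbb{N}^{Q_0}$ be a dimension vector for $Q$. The quiver setting $(Q,\mathbf{d})$ is representation infinite (over $k$) if and only if there exists a Euclidean quiver $Q'$ such that $(Q', \mathbf{h}_{Q'}) \leq (Q,\mathbf{d})$. In other words, $(Q,\mathbf{d})$ is representation infinite if and only if $Q$ has a Euclidean subquiver $Q'$ such that $\mathbf{h}_{Q'} \leq \mathbf{d}|_{Q'_0}$.
   Context: Throughout, $k$ is an algebraically closed field, and $\mathbb{N}$ includes $0$. A quiver $Q$ consists of a finite set $Q_0$ of vertices, a finite set $Q_1$ of arrows, and maps $s,t\colon Q_1\to Q_0$ (start and terminal vertex); loops and multiple arrows are allowed. A dimension vector for $Q$ is an element $\mathbf{d}\in\mathbb{N}^{Q_0}$; inequalities between dimension vectors are coordinatewise. A quiver setting is a pair $(Q,\mathbf{d})$ of a quiver and a dimension vector for it. A representation of $Q$ of dimension vector $\mathbf{d}$ is a tuple $M=(M_\alpha)_{\alpha\in Q_1}$ of $k$-linear maps $M_\alpha\colon k^{\mathbf{d}(s\alpha)}\to k^{\mathbf{d}(t\alpha)}$. Two such representations $M,N$ are isomorphic if there is a tuple $g=(g_x)_{x\in Q_0}$ of $k$-linear automorphisms $g_x$ of $k^{\mathbf{d}(x)}$ with $N_\alpha=g_{t\alpha}M_\alpha g_{s\alpha}^{-1}$ for every $\alpha\in Q_1$. The setting $(Q,\mathbf{d})$ is representation finite if there are only finitely many isomorphism classes of representations of $Q$ of dimension vector $\mathbf{d}$, and representation infinite otherwise.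 A quiver morphism $\psi\colon Q\to Q'$ is a pair of maps $\psi_0\colon Q_0\to Q_0'$, $\psi_1\colon Q_1\to Q_1'$ with $s(\psi_1\alpha)=\psi_0(s\alpha)$ and $t(\psi_1\alpha)=\psi_0(t\alpha)$ for all $\alpha \in Q_1$; it is injective if both $\psi_0,\psi_1$ are injective. A subquiver is given by subsets of vertices and arrows containing the endpoints of its arrows (equivalently, the image of an injective quiver morphism); it need not be full. For quiver settings, $(Q,\mathbf{d})\leq(Q',\mathbf{d}')$ means that there is an injective quiver morphism $\psi\colon Q\to Q'$ with $\mathbf{d}(x)\leq\mathbf{d}'(\psi_0 x)$ for all $x\in Q_0$. A Euclidean quiver $Q$ is a quiver whose underlying graph (forget the orientation of arrows) is one of the following; the vector $\mathbf{h}_Q$ is given in each case. - $\tilde{\mathbb{A}}_n$, $n\geq 0$: a cycle with $n+1$ vertices and $n+1$ edges (for $n=0$ one vertex with one loop; for $n=1$ two vertices joined by two edges); $\mathbf{h}_Q=1$ at every vertex. - $\tilde{\mathbb{D}}_n$, $n\geq 4$ ($n+1$ vertices): a path $c_1 - \cdots - c_{n-3}$, with two further vertices attached by an edge to $c_1$ and two further vertices attached by an edge to $c_{n-3}$ (for $n=4$ all four attached to the single vertex $c_1$); $\mathbf{h}_Q=2$ at each $c_i$ and $1$ at the four further vertices. - $\tilde{\mathbb{E}}_6$: a star with a central vertex and three arms with $2$ vertices each; $\mathbf{h}_Q=3$ at the center and $2,1$ along each arm, going outward. - $\tilde{\mathbb{E}}_7$: a star with a central vertex and three arms with $3,3,1$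 vertices; $\mathbf{h}_Q=4$ at the center, $3,2,1$ outward along each of the two long arms, and $2$ on the short arm. - $\tilde{\mathbb{E}}_8$: a star with a central vertex and three arms with $5,2,1$ vertices; $\mathbf{h}_Q=6$ at the center, $5,4,3,2,1$ outward along the arm with $5$ vertices, $4,2$ outward along the arm with $2$ vertices, and $3$ on the arm with $1$ vertex. *)

(* Defs.v *)
From mathcomp Require Import all_boot all_order all_algebra.

Set Implicit Arguments.
Unset Strict Implicit.
Unset Printing Implicit Defensive.

Record quiver := Quiver {
  vertex : finType;
  arrow : finType;
  src : arrow -> vertex;
  tgt : arrow -> vertex
}.

Definition dim_vector (Q : quiver) := vertex Q -> nat.

(* Linear maps k^m -> k^n are n x m matrices acting on column vectors. *)
Definition representation (k : fieldType) (Q : quiver) (d : dim_vector Q) :=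
  forall a : arrow Q, 'M[k]_(d (tgt a), d (src a)).

Definition rep_iso (k : fieldType) (Q : quiver) (d : dim_vector Q)
    (M N : representation k d) : Prop :=
  exists g : forall x : vertex Q, 'M[k]_(d x),
    (forall x, g x \in unitmx) /\
    (forall a, N a = (g (tgt a) *m M a *m invmx (g (src a)))%R).

Definition representation_finite (k : fieldType) (Q : quiver)
    (d : dim_vector Q) : Prop :=
  exists (n : nat) (M : 'I_n -> representation k d),
    forall N : representation k d, exists i, rep_iso (M i) N.

Definition representation_infinite (k : fieldType) (Q : quiver)
    (d : dim_vector Q) : Prop :=
  ~ representation_finite k d.

Record quiver_morphism (Q Q' : quiver) := QuiverMorphism {
  mor_vertex : vertex Q -> vertex Q';
  mor_arrow : arrow Q -> arrow Q';
  mor_src : forall a, src (mor_arrow a) = mor_vertex (src a);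
  mor_tgt : forall a, tgt (mor_arrow a) = mor_vertex (tgt a)
}.

Definition injective_morphism (Q Q' : quiver) (psi : quiver_morphism Q Q') :
    Prop :=
  injective (mor_vertex psi) /\ injective (mor_arrow psi).

Definition setting_le (Q : quiver) (d : dim_vector Q)
    (Q' : quiver) (d' : dim_vector Q') : Prop :=
  exists psi : quiver_morphism Q Q',
    injective_morphism psi /\ (forall x, d x <= d' (mor_vertex psi x)).

Record subquiver (Q : quiver) := Subquiver {
  sub_vertices : {set vertex Q};
  sub_arrows : {set arrow Q};
  sub_src : forall a, a \in sub_arrows -> src a \in sub_vertices;
  sub_tgt : forall a, a \in sub_arrows -> tgt a \in sub_vertices
}.

Definition quiver_of_sub (Q : quiver) (S : subquiver Q) : quiver :=
  @Quiver {x : vertex Q | x \in sub_vertices S}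
          {a : arrow Q | a \in sub_arrows S}
    (fun a => exist _ (src (val a)) (sub_src (valP a)))
    (fun a => exist _ (tgt (val a)) (sub_tgt (valP a))).
Coercion quiver_of_sub : subquiver >-> quiver.

Definition restrict_dim (Q : quiver) (d : dim_vector Q) (S : subquiver Q) :
    dim_vector S :=
  fun x => d (val x).

(* Undirected multigraphs: the ends of an edge form a set of one (loop) or two
   vertices. *)
Record graph := Graph {
  node : finType;
  edge : finType;
  ends : edge -> {set node}
}.

Definition underlying_graph (Q : quiver) : graph :=
  @Graph (vertex Q) (arrow Q) (fun a => [set src a; tgt a]).

Record graph_iso (G H : graph) := GraphIso {
  iso_node : node G -> node H;
  iso_edge : edge G -> edge H;
  iso_node_bij : bijective iso_node;
  iso_edge_bij : bijective iso_edge;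
  iso_ends : forall e, ends (iso_edge e) = iso_node @: ends e
}.

(* ordS is the cyclic successor, so n = 0 gives a loop and n = 1 a double
   edge. *)
Definition cycle_graph (n : nat) : graph :=
  @Graph 'I_n.+1 'I_n.+1 (fun i => [set i; ordS i]).

(* The type D~_(m + 4): the nodes inl i are the path c_1, ..., c_(m + 1), and
   inr (b, b') are the further vertices, b selecting the end of the path. *)
Definition Dtilde_graph (m : nat) : graph :=
  @Graph ('I_m.+1 + bool * bool)%type ('I_m + bool * bool)%type
    (fun e => match e with
      | inl i => [set inl (widen_ord (leqnSn m) i); inl (lift ord0 i)]
      | inr u => [set inr u; inl (if u.1 then ord_max else ord0)]
      end).

(* A star with centre None and arms of p, q and r vertices, numbered outward
   from 0; each arm vertex is identified with the edge joining it to its inward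
   neighbour. *)
Definition star_inward (p q r : nat) (v : 'I_p + 'I_q + 'I_r) :
    option ('I_p + 'I_q + 'I_r) :=
  match v with
  | inl (inl i) => if val i == 0 then None else Some (inl (inl (ord_pred i)))
  | inl (inr i) => if val i == 0 then None else Some (inl (inr (ord_pred i)))
  | inr i => if val i == 0 then None else Some (inr (ord_pred i))
  end.

Definition star_graph (p q r : nat) : graph :=
  @Graph (option ('I_p + 'I_q + 'I_r)) ('I_p + 'I_q + 'I_r)%type
    (fun v => [set Some v; star_inward v]).

Definition star_weight (p q r : nat) (c : nat) (s1 s2 s3 : seq nat)
    (v : node (star_graph p q r)) : nat :=
  match v with
  | None => c
  | Some (inl (inl i)) => nth 0 s1 i
  | Some (inl (inr i)) => nth 0 s2 i
  | Some (inr i) => nth 0 s3 i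
  end.

(* EucA n is A~_n and EucD m is D~_(m + 4). *)
Inductive euclidean_type :=
  EucA of nat | EucD of nat | EucE6 | EucE7 | EucE8.

Definition euclidean_graph (T : euclidean_type) : graph :=
  match T with
  | EucA n => cycle_graph n
  | EucD m => Dtilde_graph m
  | EucE6 => star_graph 2 2 2
  | EucE7 => star_graph 3 3 1
  | EucE8 => star_graph 5 2 1
  end.

Definition euclidean_weight (T : euclidean_type) :
    node (euclidean_graph T) -> nat :=
  match T with
  | EucA n => fun=> 1
  | EucD m => fun v => if v is inl _ then 2 else 1
  | EucE6 => @star_weight 2 2 2 3 [:: 2; 1] [:: 2; 1] [:: 2; 1]
  | EucE7 => @star_weight 3 3 1 4 [:: 3; 2; 1] [:: 3; 2; 1] [:: 2]
  | EucE8 => @star_weight 5 2 1 6 [:: 5; 4; 3; 2; 1] [:: 4; 2] [:: 3]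
  end.

Record euclidean (Q : quiver) := Euclidean {
  euc_type : euclidean_type;
  euc_iso : graph_iso (underlying_graph Q) (euclidean_graph euc_type)
}.

(* The vector h_Q. It does not depend on the chosen identification E, since
   isomorphisms between the graphs above preserve the weights. *)
Definition euclidean_vector (Q : quiver) (E : euclidean Q) : dim_vector Q :=
  fun x => euclidean_weight (iso_node (euc_iso E) x).

(* Main.v *)
Require Import Defs.
From HB Require Import structures.
From mathcomp Require Import mpoly all_boot all_order all_algebra zify.
From Stdlib Require Import Classical ClassicalEpsilon FunctionalExtensionality.

Set Implicit Arguments.
Unset Strict Implicit.
Unset Printing Implicit Defensive.

Import GRing.Theory.

(** Write $q(d) = \sum_x d_x^2 - \sum_a d_{sa} d_{ta}$ for the Tits form of a
    quiver.  The theorem follows from the equivalence of three properties of a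
    setting: it is representation infinite; $q(d') \le 0$ for some nonzero
    $d' \le d$; it contains a Euclidean setting.

    A Euclidean vector [h] satisfies $q(h) \le 0$ ([euclidean_vector_tits]), and
    $q(h) \le 0$ forces infinitely many classes by a count of parameters
    ([tits_nonpos_infinite]): modulo scalars the group acting on the
    representations of dimension vector [h] has fewer dimensions than the space
    on which it acts, and finitely many rational maps from a smaller affine
    space cannot cover a larger one ([rational_maps_not_surjective]).  Infinity
    passes from [h] to [d] by extension by zero, which is injective on
    isomorphism classes ([pad_cancel]).

    Suppose conversely that $q(d') > 0$ for all nonzero $d' \le d$.  Then every
    indecomposable representation of dimension vector at most [d] is rigid, that
    is, has no self-extensions ([indecomposable_rigid]).  Indeed
    $q(d) = \dim \mathrm{End}(M) - \dim \mathrm{Ext}^1(M, M)$, so that a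
    representation with only scalar endomorphisms is rigid ([brick_rigid]), and
    by Ringel's argument any other indecomposable one has a proper
    subrepresentation that is indecomposable and not rigid
    ([least_rank_square_nonzero]).  Two rigid representations of the same
    dimension vector are isomorphic, since both are isomorphic to the general
    point of the line joining them ([rigid_unique]).  Hence there are finitely
    many classes, by induction on the dimension vector
    ([weakly_positive_finite]).

    Finally let [f] be a minimal nonzero vector below [d] with $q(f) \le 0$.  If
    loops and double arrows are absent from its support, then minimality makes
    [f] additive, $2 f_x = \sum_{y \sim x} f_y$ ([minimal_additive]).  In the
    absence of cycles, a plateau where [f] is maximal, or a second branch
    vertex, gives type D; otherwise the support has one branch vertex with three arms
    along which [f] decreases linearly to 0, and additivity at the branch vertex
    leaves the types E only ([additive_classification]). *)

(** * Linear algebra *)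

(** The rank factorization [im_in A *m im_proj A] of [A], with one-sided
    inverses of its factors.  They are sealed because their unfoldings are
    themselves products, which rewriting by associativity would rearrange. *)
HB.lock Definition im_in (k : fieldType) m n (A : 'M[k]_(m, n)) := col_base A.
HB.lock Definition im_proj (k : fieldType) m n (A : 'M[k]_(m, n)) := row_base A.
HB.lock Definition im_out (k : fieldType) m n (A : 'M[k]_(m, n)) :=
  pinvmx (col_base A).
HB.lock Definition im_sec (k : fieldType) m n (A : 'M[k]_(m, n)) :=
  pinvmx (row_base A).

Section LinearAlgebra.
Variable k : fieldType.
Local Open Scope ring_scope.

Lemma eq_mx_no_row m n (A B : 'M[k]_(m, n)) : m = 0%N -> A = B.
Proof. by move=> m0; subst m; rewrite [A]flatmx0 [B]flatmx0. Qed.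

Lemma inj_row_full m n (A : 'M[k]_(m, n)) :
  (forall v : 'cV_n, A *m v = 0 -> v = 0) -> row_full A.
Proof.
move=> Ainj; rewrite -col_leq_rank -mxrank_tr row_leq_rank.
apply: inj_row_free => v /(congr1 trmx); rewrite trmx_mul trmxK trmx0.
by move/Ainj/(congr1 trmx); rewrite trmxK trmx0.
Qed.

Definition ker_dim m n (A : 'M[k]_(m, n)) := \rank (kermx A^T).

Definition ker_in m n (A : 'M[k]_(m, n)) : 'M_(n, ker_dim A) :=
  (row_base (kermx A^T))^T.

Definition ker_out m n (A : 'M[k]_(m, n)) : 'M_(ker_dim A, n) :=
  (pinvmx (row_base (kermx A^T)))^T.

Lemma ker_inK m n (A : 'M[k]_(m, n)) : ker_out A *m ker_in A = 1%:M.
Proof. by rewrite -trmx_mul mulmxVp ?row_base_free // trmx1. Qed.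

Lemma mul_ker_in m n (A : 'M[k]_(m, n)) : A *m ker_in A = 0.
Proof.
apply: trmx_inj; rewrite trmx_mul trmxK trmx0.
by apply/sub_kermxP; rewrite eq_row_base.
Qed.

Lemma ker_in_out m n p (A : 'M[k]_(m, n)) (B : 'M_(n, p)) :
  A *m B = 0 -> ker_in A *m (ker_out A *m B) = B.
Proof.
move=> AB0; apply: trmx_inj; rewrite !trmx_mul !trmxK.
by rewrite mulmxKpV // eq_row_base; apply/sub_kermxP; rewrite -trmx_mul AB0 trmx0.
Qed.

Lemma im_factor m n (A : 'M[k]_(m, n)) : im_in A *m im_proj A = A.
Proof. by rewrite im_in.unlock im_proj.unlock mulmx_base. Qed.

Lemma im_inK m n (A : 'M[k]_(m, n)) : im_out A *m im_in A = 1%:M.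
Proof. by rewrite im_out.unlock im_in.unlock mulVpmx ?col_base_full. Qed.

Lemma im_projK m n (A : 'M[k]_(m, n)) : im_proj A *m im_sec A = 1%:M.
Proof. by rewrite im_proj.unlock im_sec.unlock mulmxVp ?row_base_free. Qed.

Lemma im_in_inj m n p (A : 'M[k]_(m, n)) :
  injective (mulmx (im_in A) : 'M_(_, p) -> _).
Proof.
by apply: (can_inj (g := mulmx (im_out A))) => B; rewrite mulmxA im_inK mul1mx.
Qed.

Lemma im_proj_inj m n p (A : 'M[k]_(m, n)) :
  injective ((@mulmx _ p _ _)^~ (im_proj A)).
Proof.
apply: (can_inj (g := mulmx^~ (im_sec A))) => B.
by rewrite -mulmxA im_projK mulmx1.
Qed.

Lemma mul_im_sec m n (A : 'M[k]_(m, n)) : A *m im_sec A = im_in A.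
Proof. by rewrite -[X in X *m _]im_factor -mulmxA im_projK mulmx1. Qed.

Lemma mul_im_out m n (A : 'M[k]_(m, n)) : im_out A *m A = im_proj A.
Proof. by rewrite -[X in _ *m X]im_factor mulmxA im_inK mul1mx. Qed.

(** [1%:M - im_sec A *m im_proj A] maps to the kernel of [A]. *)
Lemma factor_im_proj m n p (A : 'M[k]_(m, n)) (B : 'M_(p, n)) :
  B *m ker_in A = 0 -> B *m im_sec A *m im_proj A = B.
Proof.
move=> Bker; rewrite -mulmxA.
suff: B *m (1%:M - im_sec A *m im_proj A) = 0.
  by rewrite mulmxBr mulmx1 => /eqP; rewrite subr_eq0 => /eqP <-.
rewrite -(@ker_in_out _ _ _ A (_ - _)); first by rewrite mulmxA Bker mul0mx.
by rewrite mulmxBr mulmx1 mulmxA mul_im_sec im_factor subrr.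
Qed.

Lemma idempotent_im n (e : 'M[k]_n) : e *m e = e -> im_proj e *m im_in e = 1%:M.
Proof.
move=> ee; apply: (@im_in_inj _ _ _ e); apply: (@im_proj_inj _ _ _ e).
by rewrite mulmx1 mulmxA im_factor -mulmxA im_factor ee.
Qed.

(** The kernel of [A] and its cokernel have the same dimension, [c] embeds the
    former and [b] covers the latter, so a suitable [X] makes [b X c] an
    isomorphism between them. *)
Lemma unit_completion n m (A : 'M[k]_n) (b : 'M_(n, m)) (c : 'M_(m, n)) :
    (forall v : 'rV_n, v *m A = 0 -> v *m b = 0 -> v = 0) ->
    (forall v : 'cV_n, A *m v = 0 -> c *m v = 0 -> v = 0) ->
  exists X : 'M_m, A + b *m X *m c \in unitmx.
Proof.
move=> Ab_inj Ac_inj.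
pose K := row_base (kermx A); pose C := col_base (cokermx A).
have KA : K *m A = 0 by apply/sub_kermxP; rewrite eq_row_base.
have AC : A *m C = 0.
  apply: (@row_free_inj _ _ _ _ (row_base (cokermx A))).
    exact: row_base_free.
  by rewrite -mulmxA mulmx_base mulmx_coker mul0mx.
have C_full : row_full C by apply: col_base_full.
clearbody C.
have /row_freeP[R KbR] : row_free (K *m b).
  apply: inj_row_free => w; rewrite mulmxA => wKb.
  have /Ab_inj/(_ wKb) : w *m K *m A = 0 by rewrite -mulmxA KA mulmx0.
  move=> wK0; apply: (@row_free_inj _ _ _ _ K); first exact: row_base_free.
  by rewrite wK0 mul0mx.
have /row_fullP[L LcC] : row_full (c *m C).
  apply: inj_row_full => w; rewrite -mulmxA => cCw.
  have /Ac_inj/(_ cCw) : A *m (C *m w) = 0 by rewrite mulmxA AC mul0mx.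
  move=> Cw0; apply: (row_full_inj C_full).
  by rewrite Cw0 mulmx0.
have eq_dim : \rank (cokermx A) = \rank (kermx A).
  by rewrite mxrank_coker mxrank_ker.
have [Z [Z' ZK]] : exists (Z : 'M[k]_(\rank (kermx A), \rank (cokermx A))) Z',
    Z *m Z' = 1%:M.
  by rewrite eq_dim; exists 1%:M, 1%:M; rewrite mulmx1.
exists (R *m Z *m L); rewrite -row_free_unit; apply: inj_row_free => v.
rewrite mulmxDr => vX0.
have vbR0 : v *m (b *m R) = 0.
  have := congr1 (fun u => u *m C *m Z') vX0.
  rewrite !mul0mx mulmxDl -(mulmxA v) AC mulmx0 add0r -!mulmxA.
  by rewrite (mulmxA c) (mulmxA L) LcC mul1mx ZK mulmx1.
have vA0 : v *m A = 0 by move: vX0; rewrite !mulmxA -(mulmxA v) vbR0 !mul0mx addr0.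
have /submxP[w vw] : (v <= K)%MS by rewrite eq_row_base; apply/sub_kermxP.
by move: vbR0; rewrite vw -mulmxA (mulmxA K) KbR mulmx1 => ->; rewrite mul0mx.
Qed.

End LinearAlgebra.

(** * Morphisms of representations *)

Section Morphisms.
Variables (k : fieldType) (Q : quiver).
Local Open Scope ring_scope.
Implicit Types d : dim_vector Q.

Definition is_mor d d' (M : representation k d) (N : representation k d')
    (f : forall x, 'M[k]_(d' x, d x)) : Prop :=
  forall a, N a *m f (src a) = f (tgt a) *m M a.

Lemma is_mor_comp d1 d2 d3 (L : representation k d1) (M : representation k d2)
    (N : representation k d3) f g :
  is_mor L M f -> is_mor M N g -> is_mor L N (fun x => g x *m f x).
Proof.
by move=> fP gP a; rewrite mulmxA gP -mulmxA fP mulmxA.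
Qed.

Lemma is_mor1 d (M : representation k d) : is_mor M M (fun=> 1%:M).
Proof. by move=> a; rewrite mulmx1 mul1mx. Qed.

Lemma is_morB d d' (M : representation k d) (N : representation k d') f g :
  is_mor M N f -> is_mor M N g -> is_mor M N (fun x => f x - g x).
Proof. by move=> fP gP a; rewrite mulmxBr mulmxBl fP gP. Qed.

Lemma is_morD d d' (M : representation k d) (N : representation k d') f g :
  is_mor M N f -> is_mor M N g -> is_mor M N (fun x => f x + g x).
Proof. by move=> fP gP a; rewrite mulmxDr mulmxDl fP gP. Qed.

Lemma is_morZ d d' (M : representation k d) (N : representation k d') f c :
  is_mor M N f -> is_mor M N (fun x => c *: f x).
Proof. by move=> fP a; rewrite -scalemxAr -scalemxAl fP. Qed.

Lemma is_mor_inv d (M N : representation k d) f :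
    (forall x, f x \in unitmx) -> is_mor M N f ->
  is_mor N M (fun x => invmx (f x)).
Proof.
move=> fU fP a; rewrite -[LHS](mulKmx (fU (tgt a))); congr (_ *m _).
by rewrite mulmxA -fP mulmxK.
Qed.

Lemma rep_isoP d (M N : representation k d) :
  rep_iso M N <-> exists g, (forall x, g x \in unitmx) /\ is_mor M N g.
Proof.
split=> -[g [gU gP]]; exists g; split=> // a; first by rewrite gP mulmxKV.
by rewrite -gP mulmxK.
Qed.

Lemma rep_iso_sym d (M N : representation k d) : rep_iso M N -> rep_iso N M.
Proof.
move=> /rep_isoP[g [gU gP]]; apply/rep_isoP.
exists (fun x => invmx (g x)); split; first by move=> x; rewrite unitmx_inv.
exact: is_mor_inv.
Qed.

Lemma rep_iso_trans d (L M N : representation k d) :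
  rep_iso L M -> rep_iso M N -> rep_iso L N.
Proof.
move=> /rep_isoP[g [gU gP]] /rep_isoP[h [hU hP]]; apply/rep_isoP.
exists (fun x => h x *m g x); split; last exact: is_mor_comp gP hP.
by move=> x; rewrite unitmx_mul hU gU.
Qed.

(** The kernel of this linear map consists of the morphisms from [M] to [N], and
    its cokernel is $\mathrm{Ext}^1(M, N)$. *)
Definition ext_map d d' (M : representation k d) (N : representation k d')
    (f : forall x, 'M[k]_(d' x, d x)) : forall a, 'M[k]_(d' (tgt a), d (src a)) :=
  fun a => N a *m f (src a) - f (tgt a) *m M a.

Definition ext_vanishes d d' (M : representation k d) (N : representation k d') :
    Prop :=
  forall h : forall a, 'M[k]_(d' (tgt a), d (src a)),
    exists f, forall a, h a = ext_map M N f a.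

Definition rigid d (M : representation k d) : Prop := ext_vanishes M M.

Lemma is_morP d d' (M : representation k d) (N : representation k d') f :
  is_mor M N f <-> forall a, ext_map M N f a = 0.
Proof.
split=> fP a; first by rewrite /ext_map fP subrr.
by apply/eqP; rewrite -subr_eq0; apply/eqP/fP.
Qed.

(** ** Images and kernels *)

Definition image_rep d d' (N : representation k d') (f : forall x, 'M[k]_(d' x, d x)) :
    representation k (fun x => \rank (f x)) :=
  fun a => im_out (f (tgt a)) *m N a *m im_in (f (src a)).

Lemma image_in_mor d d' (M : representation k d) (N : representation k d') f :
  is_mor M N f -> is_mor (image_rep N f) N (fun x => im_in (f x)).
Proof.
move=> fP a; rewrite /image_rep.
have NC : N a *m im_in (f (src a)) = f (tgt a) *m M a *m im_sec (f (src a)).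
  by rewrite -fP -mulmxA mul_im_sec.
rewrite -mulmxA NC -!mulmxA (mulmxA (im_out _)) mul_im_out.
by rewrite (mulmxA (im_in _)) im_factor.
Qed.

Lemma image_proj_mor d d' (M : representation k d) (N : representation k d') f :
  is_mor M N f -> is_mor M (image_rep N f) (fun x => im_proj (f x)).
Proof.
by move=> fP a; rewrite /image_rep -!mulmxA im_factor fP mulmxA mul_im_out.
Qed.

Definition kernel_rep d d' (M : representation k d) (f : forall x, 'M[k]_(d' x, d x)) :
    representation k (fun x => ker_dim (f x)) :=
  fun a => ker_out (f (tgt a)) *m M a *m ker_in (f (src a)).

Lemma kernel_inj_mor d d' (M : representation k d) (N : representation k d') f :
  is_mor M N f -> is_mor (kernel_rep M f) M (fun x => ker_in (f x)).
Proof.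
move=> fP a; rewrite /kernel_rep -(mulmxA (ker_out _)) ker_in_out //.
by rewrite mulmxA -fP -mulmxA mul_ker_in mulmx0.
Qed.

End Morphisms.

(** * Finitely many isomorphism classes *)

Section FinitelyMany.
Variables (k : fieldType) (Q : quiver).
Implicit Types d : dim_vector Q.

Definition finitely_many d (P : representation k d -> Prop) : Prop :=
  exists (I : finType) (F : I -> representation k d),
    forall N, P N -> exists i, rep_iso (F i) N.

Lemma finitely_manyP d :
  representation_finite k d <-> finitely_many (fun _ : representation k d => True).
Proof.
split=> [[n [F FP]] | [I [F FP]]].
  by exists 'I_n, F => N _; apply: FP.
exists #|I|, (fun i => F (enum_val i)) => N.
by have [i Fi] := FP N Logic.I; exists (enum_rank i); rewrite enum_rankK.
Qed.

Lemma finitely_many_sub d (P P' : representation k d -> Prop) :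
  (forall N, P' N -> P N) -> finitely_many P -> finitely_many P'.
Proof. by move=> sP'P [I [F FP]]; exists I, F => N /sP'P/FP. Qed.

Lemma finitely_many_bigU d (J : finType) (P : J -> representation k d -> Prop) :
  (forall j, finitely_many (P j)) -> finitely_many (fun N => exists j, P j N).
Proof.
move=> /(_ _)/constructive_indefinite_description => finP.
pose I j : finType := sval (finP j).
have /(_ _)/constructive_indefinite_description FP := fun j => svalP (finP j).
exists {j : J & I j}, (fun u => sval (FP (tag u)) (tagged u)) => N [j PN].
have [i Fi] := svalP (FP j) N PN.
by exists (Tagged I i).
Qed.

Lemma finitely_many_class d (P : representation k d -> Prop) :
  (forall M N, P M -> P N -> rep_iso M N) -> finitely_many P.
Proof.
move=> Piso; have [[M PM] | noP] := classic (exists M, P M).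
  by exists unit, (fun=> M) => N PN; exists tt; apply: Piso.
by exists void, (of_void _) => N PN; case: noP; exists N.
Qed.

End FinitelyMany.

(** * Extension by zero *)

Section ExtensionByZero.
Variables (k : fieldType) (Q Q' : quiver) (psi : quiver_morphism Q' Q).
Variables (d' : dim_vector Q') (d : dim_vector Q).
Hypothesis psi_inj : injective_morphism psi.
Hypothesis le_d'd : forall x, d' x <= d (mor_vertex psi x).
Local Open Scope ring_scope.

(** The partial identities [pid_mx] have whatever size the context requires, so
    that [d (mor_vertex psi x)] need not be split as a sum. *)
Definition pad (N : representation k d') : representation k d :=
  fun a => if [pick b | mor_arrow psi b == a] is Some b
    then pid_mx (d' (tgt b)) *m N b *m pid_mx (d' (src b)) else 0.

Lemma pad_mor (N : representation k d') b :
  pad N (mor_arrow psi b) = pid_mx (d' (tgt b)) *m N b *m pid_mx (d' (src b)).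
Proof.
rewrite /pad; case: pickP => [c /eqP/psi_inj.2 -> // | /(_ b)].
by rewrite eqxx.
Qed.

Lemma pid_mxK m n : (n <= m)%N ->
  (pid_mx n : 'M[k]_(n, m)) *m (pid_mx n : 'M_(m, n)) = 1%:M.
Proof. by move=> le_nm; rewrite pid_mx_id // pid_mx_1. Qed.

(** Let [g] be an isomorphism of the extended representations, with diagonal
    block [A] and off-diagonal blocks [b] and [c].  The complement carries zero
    maps only, so that every family [X] of linear maps is an endomorphism of it
    and [A + b X c] is again a morphism from [M] to [N]; some choice of [X]
    makes it invertible. *)
Lemma pad_cancel (M N : representation k d') :
  rep_iso (pad M) (pad N) -> rep_iso M N.
Proof.
move=> /rep_isoP[g [gU gP]]; apply/rep_isoP.
pose J y n : 'M[k]_(d y) := (pid_mx n : 'M_(d y, n)) *m (pid_mx n : 'M_(n, d y)).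
pose P y n : 'M[k]_(d y) := 1%:M - J y n.
have P_split y n : J y n + P y n = 1%:M by rewrite addrC subrK.
have JP y n : (n <= d y)%N -> (pid_mx n : 'M_(n, d y)) *m P y n = 0.
  by move=> le_n; rewrite mulmxBr mulmx1 mulmxA pid_mxK // mul1mx subrr.
have PJ y n : (n <= d y)%N -> P y n *m (pid_mx n : 'M_(d y, n)) = 0.
  by move=> le_n; rewrite mulmxBl mul1mx -mulmxA pid_mxK // mulmx1 subrr.
pose A y n : 'M[k]_n := pid_mx n *m g y *m pid_mx n.
pose b y n : 'M[k]_(n, d y) := pid_mx n *m g y *m P y n.
pose c y n : 'M[k]_(d y, n) := P y n *m g y *m pid_mx n.
have blocks e : let M' := pid_mx (d' (tgt e)) *m M e *m pid_mx (d' (src e)) in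
    let N' := pid_mx (d' (tgt e)) *m N e *m pid_mx (d' (src e)) in
    N' *m g (src (mor_arrow psi e)) = g (tgt (mor_arrow psi e)) *m M'.
  by rewrite /= -!pad_mor gP.
have le_src e : (d' (src e) <= d (src (mor_arrow psi e)))%N.
  by rewrite mor_src.
have le_tgt e : (d' (tgt e) <= d (tgt (mor_arrow psi e)))%N.
  by rewrite mor_tgt.
have Amor e : N e *m A (mor_vertex psi (src e)) (d' (src e))
    = A (mor_vertex psi (tgt e)) (d' (tgt e)) *m M e.
  have := congr1 (fun B => (pid_mx (d' (tgt e)) : 'M_(d' (tgt e), _)) *m B
    *m (pid_mx (d' (src e)) : 'M_(_, d' (src e))))
    (blocks e).
  rewrite /= !mulmxA pid_mxK // mul1mx -!mulmxA pid_mxK // mulmx1 !mulmxA.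
  by rewrite -!mulmxA !(mulmxA (pid_mx _)) mor_src mor_tgt.
have bmor e : N e *m b (mor_vertex psi (src e)) (d' (src e)) = 0.
  have := congr1 (fun B => (pid_mx (d' (tgt e)) : 'M_(d' (tgt e), _)) *m B
    *m P _ (d' (src e))) (blocks e).
  rewrite /= !mulmxA pid_mxK // mul1mx -!mulmxA.
  by rewrite JP // !mulmx0 mor_src.
have cmor e : c (mor_vertex psi (tgt e)) (d' (tgt e)) *m M e = 0.
  have := congr1 (fun B => P _ (d' (tgt e)) *m B
    *m (pid_mx (d' (src e)) : 'M_(_, d' (src e))))
    (blocks e).
  rewrite /= !mulmxA PJ // !mul0mx.
  by rewrite -!mulmxA pid_mxK // mulmx1 !mulmxA mor_tgt => <-.
have invX x : exists X, A (mor_vertex psi x) (d' x)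
    + b (mor_vertex psi x) (d' x) *m X *m c (mor_vertex psi x) (d' x) \in unitmx.
  move: (mor_vertex psi x) (d' x) (le_d'd x) => y n le_n.
  apply: unit_completion => v vA vb.
    have: v *m pid_mx n *m g y *m (J y n + P y n) = 0.
      rewrite mulmxDr; move: vA vb; rewrite /A /b /J !mulmxA => -> ->.
      by rewrite mul0mx addr0.
    rewrite P_split mulmx1 => /(congr1 (mulmx^~ (invmx (g y)))).
    rewrite mulmxK // mul0mx => /(congr1 (mulmx^~ (pid_mx n : 'M_(d y, n)))).
    by rewrite -mulmxA pid_mxK // mulmx1 mul0mx.
  have: (J y n + P y n) *m (g y *m (pid_mx n *m v)) = 0.
    rewrite mulmxDl; move: vA vb; rewrite /A /c /J -!mulmxA => -> ->.
    by rewrite mulmx0 addr0.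
  rewrite P_split mul1mx => /(congr1 (mulmx (invmx (g y)))).
  rewrite mulKmx // mulmx0 => /(congr1 (mulmx (pid_mx n : 'M_(n, d y)))).
  by rewrite mulmxA pid_mxK // mul1mx mulmx0.
have /(_ _)/constructive_indefinite_description XP := invX.
clearbody A b c.
exists (fun x => A (mor_vertex psi x) (d' x) + b (mor_vertex psi x) (d' x)
  *m sval (XP x) *m c (mor_vertex psi x) (d' x)).
split=> [x | e]; first exact: svalP (XP x).
by rewrite mulmxDr mulmxDl Amor !mulmxA bmor !mul0mx -!mulmxA cmor !mulmx0.
Qed.

Lemma representation_finite_le :
  representation_finite k d -> representation_finite k d'.
Proof.
move=> [n [M MP]]; apply/finitely_manyP.
apply: (@finitely_many_sub _ _ _ (fun N => exists i, rep_iso (M i) (pad N))).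
  by move=> N _; apply: MP.
apply: finitely_many_bigU => i; apply: finitely_many_class => N N' iN iN'.
exact/pad_cancel/rep_iso_trans/iN'/rep_iso_sym.
Qed.

End ExtensionByZero.

(** * Families of matrices as row vectors *)

Section Families.
Variables (I : finType) (m n : I -> nat).
Local Open Scope ring_scope.

Definition entry_index : finType := {i : I & ('I_(m i) * 'I_(n i))%type}.

Lemma card_entry_index : #|entry_index| = (\sum_i m i * n i)%N.
Proof.
rewrite card_tagged sumnE big_map big_enum.
by apply: eq_bigr => i _; rewrite card_prod !card_ord.
Qed.

Definition fam_row (R : Type) (f : forall i, 'M[R]_(m i, n i)) :
    'rV[R]_#|entry_index| :=
  \row_u f (tag (enum_val u)) (tagged (enum_val u)).1 (tagged (enum_val u)).2.

Definition row_fam (R : Type) (v : 'rV[R]_#|entry_index|) i : 'M[R]_(m i, n i) :=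
  \matrix_(r, c) v 0 (enum_rank (Tagged (fun i => 'I_(m i) * 'I_(n i))%type (r, c))).

Lemma fam_rowK (R : Type) (f : forall i, 'M[R]_(m i, n i)) i :
  row_fam (fam_row f) i = f i.
Proof. by apply/matrixP => r c; rewrite !mxE enum_rankK. Qed.

Lemma row_famK (R : Type) (v : 'rV[R]_#|entry_index|) : fam_row (row_fam v) = v.
Proof.
apply/rowP => u; rewrite !mxE; congr (v 0 _).
by rewrite -[RHS]enum_valK; case: (enum_val u) => i [r c].
Qed.

Lemma eq_fam_row (R : Type) (f g : forall i, 'M[R]_(m i, n i)) :
  (forall i, f i = g i) -> fam_row f = fam_row g.
Proof. by move=> fg; apply/rowP => u; rewrite !mxE fg. Qed.

Lemma fam_rowP (R : pzRingType) (a : R) f g :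
  fam_row (fun i => a *: f i + g i) = a *: fam_row f + fam_row g.
Proof. by apply/rowP => u; rewrite !mxE. Qed.

Lemma row_famP (R : pzRingType) (a : R) u v i :
  row_fam (a *: u + v) i = a *: row_fam u i + row_fam v i.
Proof. by apply/matrixP => r c; rewrite !mxE. Qed.

Lemma map_row_fam (R S : Type) (h : R -> S) v i :
  map_mx h (row_fam v i) = row_fam (map_mx h v) i.
Proof. by apply/matrixP => r c; rewrite !mxE. Qed.

End Families.

(** * Rigid representations *)

Section Rigid.
Variables (k : fieldType) (Q : quiver).
Implicit Types d : dim_vector Q.
Local Open Scope ring_scope.

Section ExtMatrix.
Variables (d d' : dim_vector Q).
Variables (M : representation k d) (N : representation k d').

Definition ext_row (v : 'rV[k]_#|entry_index d' d|) :=
  fam_row (ext_map M N (row_fam v)).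

Fact ext_row_is_linear : linear ext_row.
Proof.
move=> a u v; rewrite /ext_row -fam_rowP; apply: eq_fam_row => e.
rewrite /ext_map !row_famP mulmxDr mulmxDl -scalemxAr -scalemxAl scalerBr.
by rewrite opprD addrACA.
Qed.

HB.instance Definition _ :=
  GRing.isLinear.Build k _ _ _ ext_row ext_row_is_linear.

Definition ext_mx := lin1_mx ext_row.

Lemma mul_fam_ext f : fam_row f *m ext_mx = fam_row (ext_map M N f).
Proof.
rewrite mul_rV_lin1; apply: eq_fam_row => e.
by rewrite /ext_map !fam_rowK.
Qed.

Lemma ext_mx_eq0 f : fam_row f *m ext_mx = 0 <-> is_mor M N f.
Proof.
rewrite mul_fam_ext is_morP; split=> [f0 e | f0].
  rewrite -(fam_rowK (ext_map M N f) e) f0.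
  by apply/matrixP => r c; rewrite !mxE.
by apply/rowP => u; rewrite mxE f0 !mxE.
Qed.

Lemma ext_vanishesP : ext_vanishes M N <-> row_full ext_mx.
Proof.
rewrite -sub1mx; split=> [ext0 | full h].
  apply/row_subP => i; set w := row i _.
  have [f wf] := ext0 (row_fam w).
  apply/submxP; exists (fam_row f).
  by rewrite mul_fam_ext -[LHS]row_famK; apply: eq_fam_row.
have /submxP[v hv] := submx_trans (submx1 (fam_row h)) full.
exists (row_fam v) => e.
by rewrite -(fam_rowK h) hv -{1}(row_famK v) mul_fam_ext fam_rowK.
Qed.

End ExtMatrix.

(** The Tits form is positive at [d]. *)
Definition tits_pos d : bool :=
  (\sum_a d (tgt a) * d (src a) < \sum_x d x * d x)%N.

(** As $q(d) = \dim \mathrm{End}(M) - \dim \mathrm{Ext}^1(M, M)$, a positive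
    value and a one-dimensional $\mathrm{End}(M)$ leave no extensions. *)
Lemma brick_rigid d (M : representation k d) :
    tits_pos d ->
    (forall f, is_mor M M f -> exists c, forall x, f x = c%:M) ->
  rigid M.
Proof.
move=> q_pos brickM; apply/ext_vanishesP; rewrite -col_leq_rank.
have ker_le1 : (\rank (kermx (ext_mx M M)) <= 1)%N.
  apply: (leq_trans _ (rank_leq_row (fam_row (fun x => 1%:M : 'M[k]_(d x))))).
  apply/mxrankS/rV_subP => v /sub_kermxP; rewrite -(row_famK v) => /ext_mx_eq0.
  move=> /brickM[c fc]; apply/submxP; exists c%:M.
  rewrite mul_scalar_mx; apply/rowP => u.
  by rewrite mxE fc !mxE mulr_natr.
move: ker_le1; rewrite mxrank_ker leq_subLR addn1 => le_rank.
by rewrite -ltnS (leq_trans _ le_rank) // !card_entry_index.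
Qed.

(** Surjectivity of [ext_mx M M] persists along the line from [M] to [N], and
    so does a polynomial solution of the equations for a morphism from [M] that
    is the identity at time [0]. *)
Lemma rigid_generic d (M N : representation k d) :
    rigid M ->
  exists P : {poly k}, P.[0] != 0 /\ forall t, P.[t] != 0 ->
    rep_iso M (fun a => (1 - t) *: M a + t *: N a).
Proof.
move=> /ext_vanishesP/row_fullP[R RA].
set A := ext_mx M M in RA; pose B := -1 *: A + ext_mx M N.
pose u := fam_row (fun x => 1%:M : 'M[k]_(d x)).
have uA0 : u *m A = 0 by apply/ext_mx_eq0/is_mor1.
pose W := 1%:M + 'X *: map_mx polyC (R *m B).
(* By Cramer's rule, [F] is the polynomial multiple by [\det W] of the solution
   [u - u *m (t *: B) *m invmx W *m R] of [v *m (A + t *: B) = 0]. *)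
pose F := \det W *: map_mx polyC u
  - map_mx polyC u *m ('X *: map_mx polyC B) *m \adj W *m map_mx polyC R.
pose Wt t := 1%:M + t *: (R *m B).
pose Ft t := \det (Wt t) *: u - u *m (t *: B) *m \adj (Wt t) *m R.
have evC t m n (C : 'M[k]_(m, n)) : map_mx (horner_eval t) (map_mx polyC C) = C.
  by apply/matrixP => i j; rewrite !mxE /horner_eval hornerC.
have evX t : horner_eval t 'X = t by rewrite /horner_eval hornerX.
have evW t : map_mx (horner_eval t) W = Wt t.
  by rewrite /W map_mxD map_mx1 map_mxZ evC /= evX.
have evF t : map_mx (horner_eval t) F = Ft t.
  rewrite /F map_mxB map_mxZ !map_mxM !evC map_mxZ map_mx_adj evW evC /= evX.
  by rewrite -det_map_mx evW.
have evP t : (\prod_x \det (row_fam F x)).[t] = \prod_x \det (row_fam (Ft t) x).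
  rewrite -/(horner_eval t _) rmorph_prod; apply: eq_bigr => x _.
  by rewrite -det_map_mx map_row_fam evF.
have FtA t : Ft t *m ext_mx M (fun a => (1 - t) *: M a + t *: N a) = 0.
  have -> : ext_mx M (fun a => (1 - t) *: M a + t *: N a) = t *: B + A.
    apply/row_matrixP => i; rewrite !rowE mulmxDr -scalemxAr mulmxDr -scalemxAr.
    rewrite -(row_famK (delta_mx 0 i)) !mul_fam_ext -!fam_rowP.
    apply: eq_fam_row => e; rewrite /ext_map mulmxDl -!scalemxAl scaleN1r opprB.
    set a := M e *m _; set b := N e *m _; set c := _ *m M e.
    rewrite [c - a + _]addrC subrKA scalerBr scalerBl scale1r addrA.
    by congr (_ - c); rewrite addrAC [RHS]addrAC [a + _]addrC.
  have RW : R *m (t *: B + A) = Wt t by rewrite mulmxDr RA -scalemxAr addrC.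
  rewrite /Ft mulmxBl -scalemxAl mulmxDr uA0 addr0 -!mulmxA RW mul_adj_mx.
  by rewrite mul_mx_scalar -!scalemxAr subrr.
exists (\prod_x \det (row_fam F x)); rewrite evP; split.
  rewrite prodf_seq_neq0; apply/allP => x _ /=.
  rewrite /Ft /Wt !scale0r mulmx0 !mul0mx subr0 addr0 det1 scale1r fam_rowK.
  by rewrite det1 oner_neq0.
move=> t; rewrite evP prodf_seq_neq0 => /allP Ft_unit; apply/rep_isoP.
exists (row_fam (Ft t)); split=> [x|]; last by apply/ext_mx_eq0; rewrite row_famK.
by rewrite unitmxE unitfE; apply: (implyP (Ft_unit x (mem_index_enum x))).
Qed.

End Rigid.

Section RigidUnique.
Local Open Scope ring_scope.

Lemma poly_nonroot (k : closedFieldType) (p : {poly k}) :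
  p != 0 -> exists t, p.[t] != 0.
Proof.
move=> p_neq0; have [/size1_polyC p1 | p_gt1] := leqP (size p) 1.
  by exists 0; move: p_neq0; rewrite p1 hornerC polyC_eq0.
have size_p : size (p - 1) = size p by rewrite size_polyDl // size_polyN size_poly1.
have /closed_rootP[t] : size (p - 1) != 1 by rewrite size_p gtn_eqF.
rewrite /root !hornerE subr_eq0 => /eqP pt1.
by exists t; rewrite pt1 oner_neq0.
Qed.

(** On the line joining two rigid representations, a general point is
    isomorphic to both. *)
Lemma rigid_unique (k : closedFieldType) (Q : quiver) (d : dim_vector Q)
    (M N : representation k d) :
  rigid M -> rigid N -> rep_iso M N.
Proof.
move=> /(rigid_generic N)[P [P0 PP]] /(rigid_generic M)[R [R0 RP]].
have [t] : exists t, (P * (R \Po (1 - 'X))).[t] != 0.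
  apply: poly_nonroot; rewrite mulf_neq0 //.
    by apply: contraNneq P0 => ->; rewrite horner0.
  apply: contraNneq R0 => Rcomp0.
  have := congr1 (horner^~ 1) Rcomp0.
  by rewrite horner_comp !hornerE subrr => ->.
rewrite hornerM horner_comp mulf_eq0 negb_or !hornerE => /andP[/PP MX /RP NX].
apply: rep_iso_trans MX (rep_iso_sym _); case: NX => g [gU gP].
by exists g; split=> // a; rewrite -gP opprB addrCA subrr addr0 addrC.
Qed.

End RigidUnique.

(** * Indecomposable representations *)

Lemma ex_min_measure (T : Type) (P : T -> Prop) (m : T -> nat) :
  (exists x, P x) -> exists x, P x /\ forall y, P y -> m x <= m y.
Proof.
move=> [x Px]; have [n] := ubnP (m x); elim: n x Px => // n IHn x Px lt_mx.
have [[y [Py lt_yx]] | x_min] := classic (exists y, P y /\ m y < m x).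
  exact: IHn Py (leq_trans lt_yx lt_mx).
exists x; split=> // y Py; rewrite leqNgt; apply/negP => lt_yx.
by case: x_min; exists y.
Qed.

Lemma leq_sum_eq (I : finType) (F G : I -> nat) :
    (forall i, F i <= G i) -> \sum_i G i <= \sum_i F i ->
  forall i, F i = G i.
Proof.
move=> leFG leGF i; apply/eqP; rewrite eqn_leq leFG /=.
rewrite -(leq_add2r (\sum_(j | j != i) G j)).
move: leGF; rewrite (bigD1 i) //= [X in _ <= X](bigD1 i) //= => leGF.
by apply: leq_trans leGF _; rewrite leq_add2l leq_sum.
Qed.

Section Indecomposable.
Variables (k : fieldType) (Q : quiver).
Implicit Types d : dim_vector Q.
Local Open Scope ring_scope.

Definition indecomposable d (M : representation k d) : Prop :=
  forall e, is_mor M M e -> (forall x, e x *m e x = e x) ->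
    (forall x, e x = 0) \/ (forall x, e x = 1%:M).

Definition nonzero d d' (f : forall x : vertex Q, 'M[k]_(d' x, d x)) : Prop :=
  exists x, f x <> 0.

Lemma not_nonzero d d' (f : forall x, 'M[k]_(d' x, d x)) :
  ~ nonzero f -> forall x, f x = 0.
Proof. by move=> f0 x; apply: NNPP => fx; apply: f0; exists x. Qed.

Definition total_rank d d' (f : forall x, 'M[k]_(d' x, d x)) : nat :=
  (\sum_(x : vertex Q) \rank (f x))%N.

Lemma idempotent_unit n (e : 'M[k]_n) : e \in unitmx -> e *m e = e -> e = 1%:M.
Proof. by move=> eU /(congr1 (mulmx (invmx e))); rewrite mulmxA mulVmx // mul1mx. Qed.

(** If the square of an endomorphism of least rank is nonzero, then its rank is
    the same, and the representation is the direct sum of the kernel and the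
    image; by indecomposability, the kernel vanishes. *)
Lemma least_rank_unit d (M : representation k d) f :
    indecomposable M -> is_mor M M f ->
    (forall g, is_mor M M g -> nonzero g -> (total_rank f <= total_rank g)%N) ->
    nonzero (fun x => f x *m f x) ->
  forall x, f x \in unitmx.
Proof.
move=> indM fM f_min ff_neq0.
pose u x := im_proj (f x) *m im_in (f x).
have uI : is_mor (image_rep M f) (image_rep M f) u.
  exact: is_mor_comp (image_in_mor fM) (image_proj_mor fM).
have ffE x : f x *m f x = im_in (f x) *m u x *m im_proj (f x).
  by rewrite -{1 2}(im_factor (f x)) !mulmxA.
have uU x : u x \in unitmx.
  rewrite -row_free_unit /row_free eqn_leq rank_leq_row /=.
  have rank_ff y : (\rank (f y *m f y) <= \rank (f y))%N by apply: mxrankM_maxl.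
  have rank_eq := leq_sum_eq rank_ff (f_min _ (is_mor_comp fM fM) ff_neq0) x.
  apply: (leq_trans (eq_leq (esym rank_eq))); rewrite ffE.
  by apply: leq_trans (mxrankM_maxl _ _) (mxrankM_maxr _ _).
pose e x := im_in (f x) *m (invmx (u x) *m im_proj (f x)).
have eM : is_mor M M e.
  apply: is_mor_comp (image_in_mor fM).
  exact: is_mor_comp (image_proj_mor fM) (is_mor_inv uU uI).
have ee x : e x *m e x = e x.
  by rewrite /e -!mulmxA (mulmxA (im_proj _)) -/(u x) mulKmx.
have [e0 | e1] := indM e eM ee => x.
  case: ff_neq0 => y []; suff ef : e y *m f y = f y by rewrite -{1}ef e0 !mul0mx.
  rewrite -[X in _ *m X = X]im_factor /e -!mulmxA (mulmxA (im_proj _)).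
  by rewrite -/(u y) mulKmx.
rewrite -row_free_unit /row_free eqn_leq rank_leq_row /=.
rewrite -{1}(mxrank1 k (d x)) -e1 /e mulmxA.
by apply: leq_trans (mxrankM_maxr _ _) _; rewrite rank_leq_row.
Qed.

End Indecomposable.

(** An endomorphism minus one of its eigenvalues is not invertible, hence it
    vanishes. *)
Lemma division_endo_scalar (k : closedFieldType) (Q : quiver) (d : dim_vector Q)
    (M : representation k d) :
    (forall f, is_mor M M f -> nonzero f -> forall x, f x \in unitmx) ->
  forall f, is_mor M M f -> exists c, forall x, f x = (c%:M)%R.
Proof.
move=> divM f fM; have [x d_gt0 | d0] := pickP (fun x => 0 < d x); last first.
  exists 0%R => x; apply/matrixP => i; case: i => i lt_i.
  by have := d0 x; rewrite (leq_ltn_trans (leq0n i) lt_i).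
have /closed_rootP[c] : size (char_poly (f x)) != 1.
  by rewrite size_char_poly eqSS -lt0n.
rewrite -eigenvalue_root_char => /eigenvalueP[v fv v_neq0].
exists c => y; apply/eqP; rewrite -subr_eq0; apply/eqP; move: y.
have gM : is_mor M M (fun y => f y - c%:M)%R.
  by apply: is_morB => // a; rewrite mul_mx_scalar mul_scalar_mx.
apply: not_nonzero => /(divM _ gM)/(_ x) gU; case/eqP: v_neq0.
rewrite -[v](mulmxK gU) mulmxBr fv mul_mx_scalar subrr mul0mx //.
Qed.

Section SquareZero.
Variables (k : fieldType) (Q : quiver).
Implicit Types d : dim_vector Q.
Local Open Scope ring_scope.

(** Ringel's argument.  Let [f] have least rank, so that its image [I] lies in
    its kernel [K], and let [K1] be a smallest direct summand of [K] to which
    [I] projects nontrivially.  Then [K1] is indecomposable, and [I] embeds in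
    [K1] because [I -> K1 -> M] has image of least rank as well.  If [K1] is
    rigid, then $\mathrm{Ext}^1(I, K_1) = 0$, so the projection from [K] to [K1]
    extends to [M], whose quotient by [K] is [I]; hence [K1] is a proper direct
    summand of [M]. *)
Lemma least_rank_square_nonzero d (M : representation k d) f :
    indecomposable M -> is_mor M M f -> nonzero f ->
    (forall g, is_mor M M g -> nonzero g -> (total_rank f <= total_rank g)%N) ->
    (forall d1 (N : representation k d1), (forall x, (d1 x <= d x)%N) ->
      (\sum_x d1 x < \sum_x d x)%N -> indecomposable N -> rigid N) ->
  nonzero (fun x => f x *m f x).
Proof.
move=> indM fM f_neq0 f_min sub_rigid; apply: NNPP => /not_nonzero ff0.
pose K := kernel_rep M f.
have KM : is_mor K M (fun x => ker_in (f x)) := kernel_inj_mor fM.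
clearbody K.
pose j x := ker_out (f x) *m f x.
have jE x : ker_in (f x) *m j x = f x by rewrite ker_in_out.
have koutE x : ker_out (f x) *m f x = j x by [].
clearbody j.
have ker_inj x m (A B : 'M_(_, m)) : ker_in (f x) *m A = ker_in (f x) *m B -> A = B.
  move/(congr1 (mulmx (ker_out (f x)))).
  by rewrite !mulmxA ker_inK !mul1mx.
have jM : is_mor M K j.
  by move=> a; apply: ker_inj; rewrite !mulmxA -KM -mulmxA !jE fM.
(* The idempotent projecting [K] onto the summand [K1]. *)
have [e [[eK ee ej] e_min]] : exists e, [/\ is_mor K K e,
    forall x, e x *m e x = e x & nonzero (fun x => e x *m j x)] /\
    forall e', [/\ is_mor K K e', forall x, e' x *m e' x = e' x
      & nonzero (fun x => e' x *m j x)] -> (total_rank e <= total_rank e')%N.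
  apply: ex_min_measure; exists (fun x => 1%:M); split=> [|x|].
  - exact: is_mor1.
  - by rewrite mulmx1.
  - have [x fx] := f_neq0; exists x; rewrite mul1mx => jx.
    by apply: fx; rewrite -jE jx mulmx0.
pose d1 x := \rank (e x); pose K1 := image_rep K e : representation k d1.
pose C x : 'M_(_, d1 x) := im_in (e x); pose R x : 'M_(d1 x, _) := im_proj (e x).
have RC x : R x *m C x = 1%:M by apply: idempotent_im.
have CR x : C x *m R x = e x by apply: im_factor.
have CK : is_mor K1 K C by apply: image_in_mor eK.
have RK : is_mor K K1 R by apply: image_proj_mor eK.
clearbody C R K1.
have K1_summand u : is_mor K1 K1 u -> (forall x, u x *m u x = u x) ->
    nonzero (fun x => C x *m u x *m R x *m j x) -> forall x, u x = 1%:M.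
  move=> uK1 uu uj_neq0 x.
  have rank_le y : (\rank (C y *m u y *m R y) <= \rank (e y))%N.
    by rewrite -mulmxA; apply: leq_trans (mxrankM_maxr _ _) (rank_leq_row _).
  have rank_eq : \rank (C x *m u x *m R x) = \rank (e x).
    apply: leq_sum_eq rank_le _ x; apply: e_min; split=> // [|y].
      apply: is_mor_comp RK _; apply: is_mor_comp uK1 CK.
    by rewrite -!mulmxA (mulmxA (R y)) RC mul1mx (mulmxA (u y)) uu.
  apply: idempotent_unit (uu x).
  rewrite -row_free_unit /row_free eqn_leq rank_leq_row /=.
  apply: leq_trans (eq_leq (esym rank_eq)) _.
  by apply: leq_trans (mxrankM_maxl _ _) (mxrankM_maxr _ _).
have indK1 : indecomposable K1.
  move=> u uK1 uu; pose v x := 1%:M - u x.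
  have vK1 : is_mor K1 K1 v by apply: is_morB uK1; apply: is_mor1.
  have vv x : v x *m v x = v x.
    by rewrite mulmxBl mul1mx mulmxBr mulmx1 uu subrr subr0.
  have [uj | /not_nonzero uj0] := classic (nonzero (fun x => C x *m u x *m R x *m j x)).
    by right; apply: K1_summand.
  left=> x; have -> : u x = 1%:M - v x by rewrite opprB addrCA subrr addr0.
  rewrite (K1_summand v) ?subrr //; have [y ejy] := ej; exists y => vj0; apply: ejy.
  move: vj0; rewrite mulmxBr mulmx1 !mulmxBl uj0 subr0 CR //.
have K_K1_mor : is_mor K1 M (fun x => ker_in (f x) *m C x) := is_mor_comp CK KM.
have split_K1 x : R x *m ker_out (f x) *m (ker_in (f x) *m C x) = 1%:M.
  by rewrite -mulmxA (mulmxA (ker_out _)) ker_inK mul1mx RC.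
have le_d1 x : (d1 x <= d x)%N by apply: mulmx1_min (split_K1 x).
have rigidK1 : rigid K1.
  apply: sub_rigid => //; rewrite ltn_neqAle leq_sum // andbT.
  apply/negP => /eqP eq_sum; have [x fx] := f_neq0; apply: fx.
  have d1E := leq_sum_eq le_d1 (eq_leq (esym eq_sum)) x.
  have full_K1 : row_free (ker_in (f x) *m C x).
    rewrite -row_leq_rank; apply: leq_trans (eq_leq (esym d1E)) _.
    apply: leq_trans (eq_leq (esym (mxrank1 k (d1 x)))) _.
    by rewrite -split_K1; apply: mxrankM_maxr.
  apply: (row_free_inj full_K1).
  by rewrite mulmxA mul_ker_in !mul0mx.
pose I := image_rep M f; pose C0 x := im_in (f x); pose R0 x := im_proj (f x).
have CR0 x : C0 x *m R0 x = f x by apply: im_factor.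
have R0M : is_mor M I R0 := image_proj_mor fM.
clearbody I.
have R0_inj x m (A B : 'M_(m, _)) : A *m R0 x = B *m R0 x -> A = B.
  by move/im_proj_inj.
pose i x := R x *m ker_out (f x) *m C0 x.
have iR0 x : i x *m R0 x = R x *m j x by rewrite /i -!mulmxA CR0 koutE.
clearbody i.
have iI : is_mor I K1 i.
  move=> a; apply: R0_inj; rewrite -!mulmxA iR0 R0M !mulmxA iR0.
  by have := is_mor_comp jM RK a; rewrite /= !mulmxA.
have i_split x : pinvmx (i x) *m i x = 1%:M.
  rewrite mulVpmx // -col_leq_rank.
  pose g y := ker_in (f y) *m C y *m i y *m R0 y.
  have gE y : g y = ker_in (f y) *m (C y *m (R y *m j y)) by rewrite /g -!mulmxA iR0.
  have g_le y : (\rank (g y) <= \rank (f y))%N.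
    by apply: leq_trans (mxrankM_maxr _ _) (rank_leq_row _).
  have rank_eq : \rank (g x) = \rank (f x).
    apply: leq_sum_eq g_le _ x; apply: f_min.
      exact: is_mor_comp R0M (is_mor_comp iI K_K1_mor).
    have [y ejy] := ej; exists y => gy; apply: ejy.
    by apply: ker_inj; rewrite mulmx0 -gy gE -CR !mulmxA.
  rewrite -[X in (X <= _)%N]rank_eq.
  by apply: leq_trans (mxrankM_maxl _ _) (mxrankM_maxr _ _).
have extI : ext_vanishes I K1.
  move=> h; have [u uE] := rigidK1 (fun a => h a *m pinvmx (i (src a))).
  exists (fun x => u x *m i x) => a.
  rewrite -[LHS]mulmx1 -(i_split (src a)) mulmxA uE /ext_map mulmxBl.
  by rewrite -!mulmxA iI.
(* [r] is the linear retraction of [M] onto [K1]; its failure to be a morphism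
   vanishes on [K], so that a map through [I] corrects it. *)
pose r x := R x *m ker_out (f x).
have rK x : r x *m ker_in (f x) = R x by rewrite -mulmxA ker_inK mulmx1.
have rC x : r x *m (ker_in (f x) *m C x) = 1%:M by apply: split_K1.
clearbody r.
have defectK a : ext_map M K1 r a *m ker_in (f (src a)) = 0.
  by rewrite /ext_map mulmxBl -!mulmxA rK KM !mulmxA rK RK subrr.
have [u uE] := extI (fun a => ext_map M K1 r a *m im_sec (f (src a))).
pose s x := r x - u x *m R0 x.
have sM : is_mor M K1 s.
  apply/is_morP => a; apply/eqP.
  have -> : ext_map M K1 s a = ext_map M K1 r a - ext_map I K1 u a *m R0 (src a).
    rewrite /ext_map /s !mulmxBr !mulmxBl -!mulmxA R0M.
    by rewrite !opprB [X in _ + X = _]addrC addrACA [- _ + _]addrC.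
  by rewrite -uE factor_im_proj ?defectK // subrr.
have s_split x : s x *m (ker_in (f x) *m C x) = 1%:M.
  rewrite /s mulmxBl rC mulmxA -(mulmxA (u x)).
  suff -> : R0 x *m ker_in (f x) = 0 by rewrite mulmx0 mul0mx subr0.
  by apply: (@im_in_inj _ _ _ _ (f x)); rewrite mulmxA CR0 mul_ker_in mulmx0.
clearbody s.
have [||e'0|e'1] := indM (fun x => ker_in (f x) *m C x *m s x).
- exact: is_mor_comp sM K_K1_mor.
- move=> x; have := s_split x; move: (ker_in (f x) *m C x) => B sB.
  by rewrite -mulmxA (mulmxA (s x)) sB mul1mx.
- have [x []] := ej; suff C0' : C x = 0 by rewrite -CR C0' !mul0mx.
  apply: ker_inj; rewrite mulmx0 -[LHS]mulmx1 -(s_split x) mulmxA.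
  by have /= -> := e'0 x; rewrite mul0mx.
- have [x []] := f_neq0; rewrite -[LHS]mulmx1.
  by have /= <- := e'1 x; rewrite !mulmxA mul_ker_in !mul0mx.
Qed.

End SquareZero.

Definition weakly_positive (Q : quiver) (d : dim_vector Q) : Prop :=
  forall d' : dim_vector Q, (forall x, d' x <= d x) -> (exists x, 0 < d' x) ->
    tits_pos d'.

Lemma indecomposable_rigid (k : closedFieldType) (Q : quiver) (d : dim_vector Q)
    (M : representation k d) :
  weakly_positive d -> indecomposable M -> rigid M.
Proof.
have [n] := ubnP (\sum_x d x); elim: n d M => // n IHn d M lt_dn posd indM.
have [M_neq0 | M0] := classic (exists f, is_mor M M f /\ nonzero f); last first.
  have d0 x : d x = 0.
    have /not_nonzero/(_ x)/= id0 : ~ nonzero (fun x => 1%:M : 'M[k]_(d x))%R.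
      move=> id_neq0; apply: M0; exists (fun x => 1%:M)%R.
      by split=> //; apply: is_mor1.
    by rewrite -(mxrank1 k (d x)) id0 mxrank0.
  by move=> h; exists (fun x => 0%R) => a; apply: eq_mx_no_row.
have [f [[fM f_neq0] f_min]] := ex_min_measure (@total_rank _ _ _ _) M_neq0.
have {}f_min g : is_mor M M g -> nonzero g -> total_rank f <= total_rank g.
  by move=> gM g_neq0; apply: f_min.
have ff_neq0 : nonzero (fun x => f x *m f x)%R.
  apply: (least_rank_square_nonzero indM fM f_neq0 f_min) => d1 N le_d1 lt_d1 indN.
  apply: (IHn d1 N _ _ indN); first exact: leq_trans lt_d1 lt_dn.
  by move=> d' le_d'; apply: posd => x; apply: leq_trans (le_d1 x).
apply: brick_rigid.
  apply: posd => //; have [x fx] := f_neq0; exists x; rewrite lt0n.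
  by apply/negP => /eqP d0; case: fx; apply: eq_mx_no_row.
apply: division_endo_scalar => g gM g_neq0 x.
have fU := least_rank_unit indM fM f_min ff_neq0.
have g_le y : \rank (g y) <= \rank (f y).
  by have := fU y; rewrite -row_free_unit => /eqP ->; apply: rank_leq_row.
rewrite -row_free_unit /row_free (leq_sum_eq g_le (f_min g gM g_neq0)).
by have := fU x; rewrite -row_free_unit.
Qed.

(** * Finiteness from positivity of the Tits form *)

Section DirectSum.
Variables (k : fieldType) (Q : quiver).
Implicit Types d : dim_vector Q.
Local Open Scope ring_scope.

(** A relation, rather than a representation of dimension vector [d1 + d2]
    made of block matrices: the dimension vector [d] of a decomposed
    representation is only pointwise equal to such a sum. *)
Definition direct_sum d1 d2 d (M1 : representation k d1) (M2 : representation k d2)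
    (M : representation k d) : Prop :=
  exists C1 R1 C2 R2, [/\ is_mor M1 M C1, is_mor M M1 R1, is_mor M2 M C2,
    is_mor M M2 R2 & forall x, [/\ R1 x *m C1 x = 1%:M, R2 x *m C2 x = 1%:M
      & C1 x *m R1 x + C2 x *m R2 x = 1%:M]].

Lemma direct_sum_iso d1 d2 d (M1 N1 : representation k d1)
    (M2 N2 : representation k d2) (M N : representation k d) :
    rep_iso M1 N1 -> rep_iso M2 N2 -> direct_sum M1 M2 M -> direct_sum N1 N2 N ->
  rep_iso M N.
Proof.
move=> /rep_isoP[u1 [u1U u1P]] /rep_isoP[u2 [u2U u2P]].
move=> [C1 [R1 [C2 [R2 [C1P R1P C2P R2P split_M]]]]].
move=> [D1 [S1 [D2 [S2 [D1P S1P D2P S2P split_N]]]]].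
apply/rep_isoP; exists (fun x => D1 x *m (u1 x *m R1 x) + D2 x *m (u2 x *m R2 x)).
split=> [x|]; last first.
  by apply: is_morD; [apply: is_mor_comp D1P | apply: is_mor_comp D2P];
    [apply: is_mor_comp u1P | apply: is_mor_comp u2P].
have [RC1 RC2 CR] := split_M x; have [SD1 SD2 DS] := split_N x.
have SD12 : S1 x *m D2 x = 0.
  have := congr1 (fun A => S1 x *m A *m D2 x) DS.
  rewrite mulmx1 mulmxDr mulmxDl !mulmxA SD1 mul1mx -!mulmxA SD2 mulmx1.
  by move/eqP; rewrite -subr_eq0 addrK => /eqP.
have SD21 : S2 x *m D1 x = 0.
  have := congr1 (fun A => S2 x *m A *m D1 x) DS.
  rewrite mulmx1 mulmxDr mulmxDl !mulmxA SD2 mul1mx -!mulmxA SD1 mulmx1.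
  by move/eqP; rewrite -subr_eq0 addrK => /eqP.
suff /mulmx1_unit[] : (C1 x *m (invmx (u1 x) *m S1 x) + C2 x *m (invmx (u2 x) *m S2 x))
    *m (D1 x *m (u1 x *m R1 x) + D2 x *m (u2 x *m R2 x)) = 1%:M by [].
rewrite mulmxDl !mulmxDr -!mulmxA !(mulmxA (S1 x)) !(mulmxA (S2 x)).
rewrite SD12 SD21 SD1 SD2 !mul0mx !mul1mx !mulmx0 addr0 add0r !mulKmx //.
Qed.

Lemma idempotent_direct_sum d (M : representation k d) e :
    is_mor M M e -> (forall x, e x *m e x = e x) ->
  exists (M1 : representation k (fun x => \rank (e x)))
    (M2 : representation k (fun x => \rank (1%:M - e x))), direct_sum M1 M2 M.
Proof.
move=> eM ee; pose e' x := 1%:M - e x.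
have e'M : is_mor M M e' by apply: is_morB eM; apply: is_mor1.
have e'e' x : e' x *m e' x = e' x.
  by rewrite mulmxBl mul1mx mulmxBr mulmx1 ee subrr subr0.
exists (image_rep M e), (image_rep M e').
exists (fun x => im_in (e x)), (fun x => im_proj (e x)),
  (fun x => im_in (e' x)), (fun x => im_proj (e' x)); split.
- exact: image_in_mor eM.
- exact: image_proj_mor eM.
- exact: image_in_mor e'M.
- exact: image_proj_mor e'M.
- move=> x; split; [exact: idempotent_im | exact: idempotent_im |].
  by rewrite !im_factor addrC subrK.
Qed.

Lemma mxrank_idempotent_compl n (e : 'M[k]_n) :
  e *m e = e -> (\rank e + \rank (1%:M - e)%R = n)%N.
Proof.
move=> ee; have e'e : (1%:M - e) *m e = 0 by rewrite mulmxBl mul1mx ee subrr.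
apply/eqP; rewrite eqn_leq; apply/andP; split.
  by rewrite addnC; apply: mulmx0_rank_max.
by have := mxrank_add (1%:M - e) e; rewrite subrK mxrank1 addnC.
Qed.

End DirectSum.

(** Decomposable representations are covered by induction on the dimension
    vector; the indecomposable ones are rigid and hence all isomorphic. *)
Theorem weakly_positive_finite (k : closedFieldType) (Q : quiver)
    (d : dim_vector Q) :
  weakly_positive d -> representation_finite k d.
Proof.
have [n] := ubnP (\sum_x d x); elim: n d => // n IHn d lt_dn posd.
apply/finitely_manyP.
(* Dimension vectors below [d], as elements of a finite type. *)
pose D := (\max_x d x).+1.
pose dims := {ffun vertex Q -> 'I_D}.
pose dim_of (u : dims) : dim_vector Q := fun x => u x.
pose summands (uv : dims * dims) (N : representation k d) :=
  exists (N1 : representation k (dim_of uv.1)) (N2 : representation k (dim_of uv.2)),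
    [/\ forall x, dim_of uv.1 x <= d x, forall x, dim_of uv.2 x <= d x,
        \sum_x dim_of uv.1 x < \sum_x d x, \sum_x dim_of uv.2 x < \sum_x d x
      & direct_sum N1 N2 N].
apply: (@finitely_many_sub _ _ _ (fun N => exists b : bool,
    if b then indecomposable N else exists uv, summands uv N)).
  move=> N _; have [indN | decN] := classic (indecomposable N); first by exists true.
  exists false.
  have [e [eN ee [e_neq0 e_neq1]]] : exists e, [/\ is_mor N N e,
      forall x, (e x *m e x)%R = e x
      & nonzero e /\ nonzero (fun x => 1%:M - e x)%R].
    apply: NNPP => no_e; case: decN => e eN ee; apply: NNPP => e01; apply: no_e.
    exists e; split=> //; split; apply: NNPP => /not_nonzero e0; apply: e01.
      by left.
    by right=> x; apply/eqP; rewrite eq_sym -subr_eq0; apply/eqP/e0.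
  have [N1 [N2 sumN]] := idempotent_direct_sum eN ee.
  have rankD x := mxrank_idempotent_compl (ee x).
  have small (d1 : dim_vector Q) : (forall x, d1 x <= d x) ->
      exists u : dims, dim_of u = d1.
    move=> le_d1; have lt_D x : d1 x < D.
      by rewrite ltnS (leq_trans (le_d1 x)) // leq_bigmax.
    exists [ffun x => Ordinal (lt_D x)]; apply: functional_extensionality => x.
    by rewrite /dim_of ffunE.
  have le1 x : \rank (e x) <= d x by rewrite rank_leq_row.
  have le2 x : \rank (1%:M - e x)%R <= d x by rewrite rank_leq_row.
  have lt1 : \sum_x \rank (e x) < \sum_x d x.
    rewrite ltn_neqAle leq_sum // andbT; apply/negP => /eqP eq_sum.
    have [x []] := e_neq1; apply/eqP; rewrite -mxrank_eq0.
    rewrite -(eqn_add2l (\rank (e x))) rankD addn0.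
    by rewrite (leq_sum_eq le1 (eq_leq (esym eq_sum))).
  have lt2 : \sum_x \rank (1%:M - e x)%R < \sum_x d x.
    rewrite ltn_neqAle leq_sum // andbT; apply/negP => /eqP eq_sum.
    have [x []] := e_neq0; apply/eqP; rewrite -mxrank_eq0.
    rewrite -(eqn_add2r (\rank (1%:M - e x)%R)) rankD add0n.
    by rewrite (leq_sum_eq le2 (eq_leq (esym eq_sum))).
  have [u uE] := small _ le1; have [v vE] := small _ le2.
  exists (u, v).
  rewrite /summands /= uE vE.
  by exists N1, N2.
apply: finitely_many_bigU => -[].
  apply: finitely_many_class => M N indM indN.
  by apply: rigid_unique; apply: indecomposable_rigid.
apply: finitely_many_bigU => -[u v].
have [[le1 [le2 [lt1 lt2]]] | no_uv] := classic ((forall x, dim_of u x <= d x) /\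
    (forall x, dim_of v x <= d x) /\ \sum_x dim_of u x < \sum_x d x
    /\ \sum_x dim_of v x < \sum_x d x); last first.
  apply: finitely_many_class => N N' [N1 [N2 [le1 le2 lt1 lt2 _]]] _.
  by case: no_uv.
have fin_le (d1 : dim_vector Q) : (forall x, d1 x <= d x) ->
    \sum_x d1 x < \sum_x d x -> representation_finite k d1.
  move=> le_d1 lt_d1; apply: IHn; first exact: leq_trans lt_d1 lt_dn.
  by move=> d' le_d'; apply: posd => x; apply: leq_trans (le_d1 x).
have [n1 [F1 F1P]] := fin_le _ le1 lt1; have [n2 [F2 F2P]] := fin_le _ le2 lt2.
apply: (@finitely_many_sub _ _ _ (fun N => exists ij : 'I_n1 * 'I_n2,
    exists N1 N2, [/\ rep_iso (F1 ij.1) N1, rep_iso (F2 ij.2) N2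
      & direct_sum N1 N2 N])).
  move=> N [N1 [N2 [_ _ _ _ sumN]]]; have [i iN1] := F1P N1; have [j jN2] := F2P N2.
  by exists (i, j), N1, N2.
apply: finitely_many_bigU => -[i j].
apply: finitely_many_class => M N [M1 [M2 [iM1 jM2 sumM]]] [N1 [N2 [iN1 jN2 sumN]]].
apply: direct_sum_iso sumM sumN.
  exact: rep_iso_trans (rep_iso_sym iM1) iN1.
exact: rep_iso_trans (rep_iso_sym jM2) jN2.
Qed.

(** * Infinitely many classes when the Tits form is not positive *)

Lemma digits_inj (D n : nat) (e f : 'I_n -> 'I_D) :
  \sum_u e u * D ^ u = \sum_u f u * D ^ u -> e =1 f.
Proof.
elim: n e f => [|n IHn] e f; first by move=> _ [].
rewrite !big_ord_recl /= !expn0 !muln1.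
have shift (g : 'I_n.+1 -> 'I_D) : \sum_(i < n) g (lift ord0 i) * D ^ bump 0 i
    = (\sum_(i < n) g (lift ord0 i) * D ^ i) * D.
  by rewrite big_distrl /=; apply: eq_bigr => i _; rewrite expnSr mulnA.
have D_gt0 : 0 < D by case: (e ord0) => i; apply: leq_ltn_trans.
rewrite !shift ![_ + _ * D]addnC => eq_sum.
have e0 : e ord0 = f ord0.
  have := congr1 (modn^~ D) eq_sum.
  by rewrite !modnMDl !modn_small // => /val_inj.
have eq_tail := congr1 (divn^~ D) eq_sum.
rewrite !divnMDl // !divn_small // !addn0 in eq_tail.
by move=> u; have [v ->|->//] := unliftP ord0 u; apply: IHn eq_tail v.
Qed.

Section Degree.
Variables (R : idomainType) (n : nat).
Local Open Scope ring_scope.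
Implicit Types p q : {mpoly R[n]}.

Definition degree_le (s : nat) p : bool := (msize p <= s.+1)%N.

Lemma degree_leM s s' p q :
  degree_le s p -> degree_le s' q -> degree_le (s + s') (p * q).
Proof.
rewrite /degree_le => ps qs'; have [->|p0] := eqVneq p 0; first by rewrite mul0r msize0.
have [->|q0] := eqVneq q 0; first by rewrite mulr0 msize0.
by rewrite msizeM // -subn1 leq_subLR add1n -addnS -addSn leq_add.
Qed.

Lemma degree_leX s p i : degree_le s p -> degree_le (i * s) (p ^+ i).
Proof.
move=> ps; elim: i => [|i IHi]; first by rewrite expr0 /degree_le msize1.
by rewrite exprS mulSn degree_leM.
Qed.

Lemma degree_le_prod (I : finType) (s : I -> nat) (F : I -> {mpoly R[n]}) :
  (forall i, degree_le (s i) (F i)) -> degree_le (\sum_i s i)%N (\prod_i F i).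
Proof.
move=> Fs; apply: (big_ind2 (fun s p => degree_le s p)) => [||i _].
- by rewrite /degree_le msize1.
- by move=> s1 p1 s2 p2; apply: degree_leM.
- exact: Fs.
Qed.

(** Bounding each exponent separately makes the monomials easy to count. *)
Lemma degree_le_eq0 (s b : nat) p : degree_le s p -> (s < b)%N ->
    (forall m : {ffun 'I_n -> 'I_b}, p@_[multinom val (m i) | i < n] = 0) ->
  p = 0.
Proof.
move=> ps lt_sb p0; apply/mpolyP => m; rewrite mcoeff0; apply/eqP/negPn/negP => pm.
have lt_m i : (m i < b)%N.
  apply: leq_trans lt_sb; rewrite ltnS; apply: (@leq_trans (mdeg m)).
    by rewrite mdegE (bigD1 i) //= leq_addr.
  by rewrite -ltnS (leq_trans _ ps) // msize_mdeg_lt // mcoeff_msupp.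
case/eqP: pm; rewrite -(p0 [ffun i => Ordinal (lt_m i)]); congr (_@__).
by apply/mnmP => i; rewrite mnmE ffunE.
Qed.

End Degree.

(** Finitely many rational maps $h_i/\delta_i$ from affine $m$-space to affine
    $n$-space with [m < n] do not cover the target.  The products
    $\prod_u (h_{i,u}/\delta_i)^{e_u}$ with all $e_u < D$ are $D^n$ in number,
    while their numerators over the common denominator $\delta_i^{nD}$ lie in
    a space of dimension $O(D^m)$; so for large [D] one linear relation holds
    between them for all [i] at once.  On the curve
    $t \mapsto (t, t^D, t^{D^2}, \dots)$ it reads as a nonzero polynomial
    equation for [t], by uniqueness of base [D] expansions. *)
Theorem rational_maps_not_surjective (k : closedFieldType) (I : finType) (m n : nat)
    (delta : I -> {mpoly k[m]}) (h : I -> 'I_n -> {mpoly k[m]}) :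
    m < n ->
  exists y : 'I_n -> k, forall i v, ((delta i).@[v] != 0)%R ->
    ~ (forall u, (h i u).@[v] = (delta i).@[v] * y u)%R.
Proof.
move=> lt_mn; pose c := \max_i (msize (delta i) + \max_u msize (h i u)).
have le_c i : msize (delta i) + \max_u msize (h i u) <= c.
  exact: (@leq_bigmax _ (fun i => msize (delta i) + \max_u msize (h i u))).
have delta_deg i : degree_le c (delta i).
  apply: leq_trans (leqnSn _); apply: leq_trans (le_c i).
  by rewrite leq_addr.
have h_deg i u : degree_le c (h i u).
  apply: leq_trans (leqnSn _); apply: leq_trans (le_c i).
  by apply: leq_trans (leq_addl _ _); apply: (@leq_bigmax _ (fun u => msize (h i u))).
(* [K * D] exceeds the degree [n * (D * c)] of the products [p i e], and [D] is
   large enough for [#|I| * (K * D) ^ m < D ^ m.+1]. *)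
pose K := (n * c).+1; pose D := (#|I| * K ^ m).+1.
pose E := {ffun 'I_n -> 'I_D}; pose S := (I * {ffun 'I_m -> 'I_(K * D)})%type.
pose p i (e : E) := (\prod_u (h i u ^+ e u * delta i ^+ (D - e u)))%R.
have p_deg i e : degree_le (n * (D * c)) (p i e).
  rewrite -{1}(card_ord n) -sum_nat_const; apply: degree_le_prod => u.
  have -> : D * c = e u * c + (D - e u) * c by rewrite -mulnDl subnKC // ltnW.
  by apply: degree_leM; apply: degree_leX.
have lt_SE : #|{: S}| < #|{: E}|.
  rewrite card_prod !card_ffun !card_ord expnMn mulnA.
  apply: (@leq_trans (D * D ^ m)); first by rewrite ltn_pmul2r ?expn_gt0.
  by rewrite -expnS leq_pexp2l.
pose A : 'M[k]_(#|{: E}|, #|{: S}|) := (\matrix_(a, s)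
  (p (enum_val s : S).1 (enum_val a))@_[multinom val ((enum_val s : S).2 l) | l < m])%R.
have /rowV0Pn[b /sub_kermxP bA b_neq0] : (kermx A != 0)%R.
  rewrite kermx_eq0 -row_leq_rank -ltnNge.
  exact: leq_ltn_trans (rank_leq_col _) lt_SE.
have rel i : (\sum_e b 0 (enum_rank e) *: p i e = 0)%R.
  apply: (@degree_le_eq0 _ _ (n * (D * c)) (K * D)) => [||mon].
  - rewrite /degree_le; apply: leq_trans (msize_sum _ _ _) _.
    apply/bigmax_leqP => e _.
    by apply: leq_trans (p_deg i e); apply: msizeZ_le.
  - by rewrite /K mulSn mulnCA mulnC -[X in X < _]add0n ltn_add2r.
  have := congr1 (fun r : 'rV_ _ => r 0%R (enum_rank (i, mon))) bA.
  rewrite !mxE => <-; rewrite raddf_sum /= (reindex (@enum_val E predT)) /=; last first.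
    by exists enum_rank => ? _; rewrite ?enum_valK ?enum_rankK.
  by apply: eq_bigr => a _; rewrite mcoeffZ !mxE enum_rankK enum_valK.
pose code (e : E) := \sum_u e u * D ^ u.
pose P : {poly k} := (\sum_e b 0 (enum_rank e) *: 'X^(code e))%R.
have P_neq0 : (P != 0)%R.
  have /rV0Pn[a ba] := b_neq0; apply: contraNneq ba => P0.
  have := congr1 (fun q : {poly k} => q`_(code (enum_val a)))%R P0.
  rewrite coef0 coef_sum (bigD1 (enum_val a)) //= coefZ coefXn eqxx mulr1 enum_valK.
  rewrite big1 ?addr0 => [-> // | e ne_e].
  rewrite coefZ coefXn eq_sym; case: eqP => [/digits_inj/ffunP eq_e|]; rewrite ?mulr0 //.
  by rewrite eq_e eqxx in ne_e.
have [t Pt] := poly_nonroot P_neq0.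
exists (fun u => t ^+ (D ^ u))%R => i v delta_v hv; case/negP: Pt.
have := congr1 (meval v) (rel i); rewrite meval0 raddf_sum /=.
have pE e : ((p i e).@[v] = (delta i).@[v] ^+ (D * n) * t ^+ code e)%R.
  have -> : ((delta i).@[v] ^+ (D * n) = \prod_(u < n) (delta i).@[v] ^+ D)%R.
    by rewrite prodr_const card_ord exprM.
  rewrite /p rmorph_prod /= /code.
  rewrite -prodrXr -big_split /=; apply: eq_bigr => u _.
  rewrite rmorphM !rmorphXn /= hv exprMn mulrAC -exprD subnKC; last exact: ltnW.
  by rewrite -exprM mulnC.
under eq_bigr => e _ do rewrite mevalZ pE mulrCA.
rewrite -mulr_sumr => /eqP; rewrite mulf_eq0 expf_eq0 (negPf delta_v) andbF /=.
move=> /eqP <-; apply/eqP; rewrite horner_sum.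
by apply: eq_bigr => e _; rewrite hornerZ hornerXn.
Qed.

Section OrbitMap.
Variables (k : fieldType) (Q : quiver) (d : dim_vector Q).
Local Open Scope ring_scope.

Let n0 := #|entry_index d d|.

(** The generic element of the group acting on representations, with its entry
    [w] normalized to [1]: the scalars act trivially, so that one of the
    coordinates of the group is superfluous. *)
Definition generic_row (w : 'I_n0) : 'rV[{mpoly k[n0.-1]}]_n0 :=
  \row_j if unlift w j is Some l then 'X_l else 1.

Definition generic_elt (w : 'I_n0) : forall x : vertex Q, 'M_(d x) :=
  row_fam (generic_row w).

Definition generic_det (w : 'I_n0) := \prod_x \det (generic_elt w x).

(** With the inverse written through the adjugate, [g M g^-1] has polynomial
    numerators over the common denominator [generic_det]. *)
Definition orbit_num (M : representation k d) (w : 'I_n0) (a : arrow Q) :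
    'M[{mpoly k[n0.-1]}]_(d (tgt a), d (src a)) :=
  (\prod_(x | x != src a) \det (generic_elt w x))
    *: (generic_elt w (tgt a) *m map_mx (@mpolyC _ k) (M a)
      *m \adj (generic_elt w (src a))).

Definition affine_point (g : forall x, 'M[k]_(d x)) (w : 'I_n0) : 'I_n0.-1 -> k :=
  fun l => fam_row g 0 (lift w l).

Lemma eval_generic_elt g w x : fam_row g 0 w = 1 ->
  map_mx (meval (affine_point g w)) (generic_elt w x) = g x.
Proof.
move=> gw; rewrite map_row_fam -[RHS](fam_rowK g); congr (row_fam _ x).
apply/rowP => j; rewrite mxE [in LHS]mxE.
by case: unliftP => [l|] ->; rewrite ?mevalXU ?meval1 ?gw.
Qed.

Lemma orbit_mapP (M N : representation k d) : (exists x, (0 < d x)%N) ->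
    rep_iso M N ->
  exists w v, (generic_det w).@[v] != 0 /\
    forall u, (fam_row (orbit_num M w) 0 u).@[v] = (generic_det w).@[v] * fam_row N 0 u.
Proof.
move=> [x0 d_gt0] /rep_isoP[g0 [g0U g0P]].
have [w gw0] : exists w, fam_row g0 0 w != 0.
  apply/rV0Pn; apply: contraTneq (g0U x0) => g00.
  rewrite -(fam_rowK g0 x0) g00 unitmxE unitfE negbK.
  have -> : row_fam 0 x0 = 0 :> 'M[k]_(d x0) by apply/matrixP => i j; rewrite !mxE.
  by case: (d x0) d_gt0 => // m _; rewrite det0.
pose c := (fam_row g0 0 w)^-1; pose g x := c *: g0 x.
have gP : is_mor M N g by apply: is_morZ.
have gU x : g x \in unitmx by rewrite unitmxZ // unitfE invr_neq0.
have gw : fam_row g 0 w = 1 by rewrite mxE mxE; move: gw0; rewrite /c mxE => /mulVf.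
exists w, (affine_point g w).
have detE : (generic_det w).@[affine_point g w] = \prod_x \det (g x).
  rewrite rmorph_prod; apply: eq_bigr => x _.
  by rewrite -det_map_mx eval_generic_elt.
split.
  rewrite detE; apply/prodf_neq0 => x _.
  by rewrite -unitfE -unitmxE; apply: gU.
move=> u; rewrite ![fam_row _ _ _]mxE; case: (enum_val u) => a [i j] /=.
have -> : (orbit_num M w a i j).@[affine_point g w]
    = map_mx (meval (affine_point g w)) (orbit_num M w a) i j by rewrite [RHS]mxE.
rewrite /orbit_num map_mxZ !map_mxM map_mx_adj /= !eval_generic_elt //.
have -> : map_mx (meval (affine_point g w)) (map_mx (@mpolyC _ k) (M a)) = M a.
  by apply/matrixP => r s; rewrite !mxE mevalC.
rewrite -gP -mulmxA mul_mx_adj mul_mx_scalar scalerA mxE detE; congr (_ * _).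
rewrite [RHS](bigD1 (src a)) //= mulrC rmorph_prod; congr (_ * _).
by apply: eq_bigr => x _; rewrite -det_map_mx eval_generic_elt.
Qed.

End OrbitMap.

(** The normalized group has $\sum_x d_x^2 - 1$ coordinates, fewer than the
    $\sum_a d_{sa} d_{ta}$ coordinates of the space of representations. *)
Theorem tits_nonpos_infinite (k : closedFieldType) (Q : quiver) (d : dim_vector Q) :
  (exists x, 0 < d x) -> ~~ tits_pos d -> representation_infinite k d.
Proof.
move=> d_neq0 q_nonpos [n [M MP]].
set n0 := #|entry_index d d|.
set n1 := #|entry_index (fun a : arrow Q => d (tgt a)) (fun a => d (src a))|.
have n0_gt0 : 0 < n0.
  have [x d_gt0] := d_neq0; rewrite /n0 card_entry_index (bigD1 x) //=.
  by rewrite addn_gt0 muln_gt0 d_gt0.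
have lt_n : n0.-1 < n1.
  by rewrite prednK // /n0 /n1 !card_entry_index leqNgt.
have [y yP] := rational_maps_not_surjective
  (fun iw : 'I_n * 'I_n0 => generic_det k iw.2)
  (fun iw : 'I_n * 'I_n0 => fun u => fam_row (orbit_num (M iw.1) iw.2) 0%R u) lt_n.
have [i Ny] := MP (row_fam (\row_u y u)%R).
have [w [v [det_neq0 hv]]] := orbit_mapP d_neq0 Ny.
case: (yP (i, w) v det_neq0) => u.
by rewrite /= hv row_famK mxE.
Qed.

(** * Weighted graphs inside quiver settings *)

(** An orientation of [G] in which every edge becomes an arrow of [Q]. *)
Definition graph_embeds (G : graph) (w : node G -> nat) (Q : quiver)
    (d : dim_vector Q) : Prop :=
  exists (phi : node G -> vertex Q) (eta : edge G -> arrow Q),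
    [/\ injective phi, injective eta,
        forall e, [set src (eta e); tgt (eta e)] = phi @: ends e
      & forall v, w v <= d (phi v)].

Lemma imset_can (S T : finType) (f : S -> T) (g : T -> S) (A : {set T}) (B : {set S}) :
  cancel f g -> f @: B = A -> B = g @: A.
Proof. by move=> fK <-; rewrite -imset_comp (eq_imset _ fK) imset_id. Qed.

Lemma embeds_subquiver (Q : quiver) (d : dim_vector Q) (T : euclidean_type) :
    graph_embeds (euclidean_weight (T:=T)) d ->
  exists (S : subquiver Q) (E : euclidean S),
    forall x : vertex S, euclidean_vector E x <= restrict_dim d x.
Proof.
move=> [phi [eta [phi_inj eta_inj endsE le_w]]].
have end_mem e x : x \in [set src (eta e); tgt (eta e)] -> x \in phi @: setT.
  by rewrite endsE => /imsetP[v _ ->]; apply: imset_f; rewrite inE.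
have srcP a : a \in eta @: setT -> src a \in phi @: setT.
  by move=> /imsetP[e _ ->]; apply: (end_mem e); rewrite set21.
have tgtP a : a \in eta @: setT -> tgt a \in phi @: setT.
  by move=> /imsetP[e _ ->]; apply: (end_mem e); rewrite set22.
pose S := Subquiver srcP tgtP; exists S.
pose node_S v : vertex S := exist _ (phi v) (imset_f phi (in_setT v)).
pose edge_S e : arrow S := exist _ (eta e) (imset_f eta (in_setT e)).
have node_bij : bijective node_S.
  apply: inj_card_bij; first by move=> u v /(congr1 val)/phi_inj.
  by rewrite card_sig card_imset // cardsT.
have edge_bij : bijective edge_S.
  apply: inj_card_bij; first by move=> u v /(congr1 val)/eta_inj.
  by rewrite card_sig card_imset // cardsT.
have [node_inv nodeK invK] := node_bij; have [edge_inv edgeK edge_invK] := edge_bij.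
have iso_ends (a : edge (underlying_graph S)) :
    @ends (euclidean_graph T) (edge_inv a) = node_inv @: ends a.
  apply: (imset_can nodeK).
  rewrite -[in RHS](edge_invK a); set e := edge_inv a.
  apply: (imset_inj val_inj); rewrite /= imsetU !imset_set1 /= endsE.
  by rewrite -imset_comp; apply: eq_imset.
exists (Euclidean (@GraphIso (underlying_graph S) (euclidean_graph T)
  node_inv edge_inv (Bijective invK nodeK) (Bijective edge_invK edgeK) iso_ends)).
move=> x; rewrite /euclidean_vector /= /restrict_dim.
by apply: leq_trans (le_w _) _; rewrite -{2}(invK x).
Qed.

Lemma subquiver_setting_le (Q : quiver) (d : dim_vector Q) (S : subquiver Q)
    (h : dim_vector S) :
  (forall x : vertex S, h x <= restrict_dim d x) -> setting_le h d.
Proof.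
move=> le_h.
pose psi := @QuiverMorphism S Q (fun x => val x) (fun a => val a)
  (fun=> erefl) (fun=> erefl).
by exists psi; split=> //; split; apply: val_inj.
Qed.

(** * The Tits form of a Euclidean quiver *)

Definition ends_weight (G : graph) (w : node G -> nat) (e : edge G) : nat :=
  \prod_(v in ends e) w v.

Lemma ends_weight2 (G : graph) (w : node G -> nat) (e : edge G) u v :
  ends e = [set u; v] -> u != v -> ends_weight w e = w u * w v.
Proof. by move=> eE neq_uv; rewrite /ends_weight eE big_setU1 ?inE //= big_set1. Qed.

Lemma big_optionE (T : finType) (F : option T -> nat) :
  \sum_u F u = F None + \sum_(v : T) F (Some v).
Proof.
rewrite (bigD1 None) //=; congr (_ + _).
rewrite (reindex_omap Some id) => [|[v|] //]; apply: eq_bigl => v /=.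
by rewrite eqxx.
Qed.

Lemma ord_pred_val n (i : 'I_n) : val i != 0 -> ord_pred i = i.-1 :> nat.
Proof.
case: n i => [[]|n] // [[|i] lt_i] //= _.
by rewrite modnDr modn_small // ltnW.
Qed.

Lemma star_inward_neq (p q r : nat) (v : 'I_p + 'I_q + 'I_r) :
  Some v != star_inward v.
Proof.
have pred_neq n (i : 'I_n) : val i != 0 -> i != ord_pred i.
  move=> i0; have i_gt0 : 0 < nat_of_ord i by rewrite lt0n.
  by apply/eqP => /(congr1 (@nat_of_ord n)); rewrite ord_pred_val //; lia.
case: v => [[i|i]|i] /=; case: ifP => //; case/negbT/pred_neq; apply: contraNneq.
all: by case=> /eqP.
Qed.

Lemma euclidean_tits (T : euclidean_type) :
  \sum_(v : node (euclidean_graph T)) euclidean_weight v * euclidean_weight v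
    <= \sum_(e : edge (euclidean_graph T)) ends_weight (@euclidean_weight T) e.
Proof.
case: T => [n | m | | |] /=.
- by rewrite /ends_weight; apply: leq_sum => i _; rewrite big1.
- have edge_path (i : 'I_m) :
      ends_weight (@euclidean_weight (EucD m)) (inl i : edge (Dtilde_graph m)) = 4.
    rewrite (@ends_weight2 (Dtilde_graph m) _ (inl i) (inl (widen_ord (leqnSn m) i))
      (inl (lift ord0 i)) (erefl _)) //.
    by apply/eqP => -[/eqP]; rewrite /bump /= add1n ltn_eqF.
  have edge_leaf (u : bool * bool) :
      ends_weight (@euclidean_weight (EucD m)) (inr u : edge (Dtilde_graph m)) = 2.
    by rewrite (@ends_weight2 (Dtilde_graph m) _ (inr u) (inr u)
      (inl (if u.1 then ord_max else ord0)) (erefl _)).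
  rewrite !big_sumType /= (eq_bigr _ (fun i _ => edge_path i)).
  rewrite (eq_bigr _ (fun u _ => edge_leaf u)) !sum_nat_const.
  rewrite !card_ord card_prod card_bool. lia.
all: rewrite (eq_bigr _ (fun e _ => @ends_weight2 (star_graph _ _ _) _ e (Some e)
  (star_inward e) (erefl _) (star_inward_neq e))).
all: by rewrite big_optionE !big_sumType /= !big_ord_recl !big_ord0.
Qed.

Lemma euclidean_weight_gt0 (T : euclidean_type) (v : node (euclidean_graph T)) :
  0 < euclidean_weight v.
Proof.
case: T v => [n|m|||] //=; first by case.
all: by case=> [[[[i lt_i]|[i lt_i]]|[i lt_i]]|] //=;
  do 6?[case: i lt_i => [|i] lt_i //].
Qed.

Lemma euclidean_vector_tits (Q : quiver) (E : euclidean Q) :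
  ~~ tits_pos (euclidean_vector E).
Proof.
set h := euclidean_vector E; rewrite /tits_pos -leqNgt.
have -> : \sum_x h x * h x
    = \sum_v euclidean_weight (T:=euc_type E) v * euclidean_weight (T:=euc_type E) v.
  by rewrite [RHS](reindex (iso_node (euc_iso E))) //; exact: onW_bij (iso_node_bij _).
apply: leq_trans (euclidean_tits _) _.
rewrite (reindex (iso_edge (euc_iso E))) /=; last first.
  exact: onW_bij (iso_edge_bij (euc_iso E)).
apply: leq_sum => a _; rewrite /ends_weight iso_ends big_imset /=; last first.
  by move=> x y _ _; apply: (bij_inj (iso_node_bij _)).
have [-> | neq] := eqVneq (tgt a) (src a); last first.
  by rewrite setUC big_setU1 ?inE //= big_set1.
by rewrite setUid big_set1 leq_pmulr // euclidean_weight_gt0.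
Qed.

Lemma euclidean_vector_neq0 (Q : quiver) (E : euclidean Q) :
  exists x, 0 < euclidean_vector E x.
Proof.
have [f _ _] := iso_node_bij (euc_iso E).
have v : node (euclidean_graph (euc_type E)).
  by case: (euc_type E) => [n|m|||]; [exact: ord0 | exact: inl ord0 | exact: None ..].
by exists (f v); apply: euclidean_weight_gt0.
Qed.

(** * Additive functions on simple graphs *)

Section AdditiveFunction.
Variables (V : finType) (E : rel V) (f : V -> nat).
Hypothesis E_sym : symmetric E.
Hypothesis E_irr : irreflexive E.
Hypothesis f_gt0 : forall x y, E x y -> 0 < f x.
Hypothesis f_additive : forall x, 0 < f x -> \sum_(y | E x y) f y = 2 * f x.

Definition has_cycle : Prop :=
  exists s, [/\ uniq s, 2 < size s & cycle E s].

(** The path from [x] consists of the vertices of weight 2 of a Dtilde graph;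
    at the four others adjacency already gives the required weight 1. *)
Definition has_Dtilde : Prop :=
  exists x p a1 a2 b1 b2, [/\ path E x p, all (fun y => 1 < f y) (x :: p),
    uniq (x :: p ++ [:: a1; a2; b1; b2]),
    E x a1 /\ E x a2 & E (last x p) b1 /\ E (last x p) b2].

Definition has_star (c0 : nat) (w1 w2 w3 : seq nat) : Prop :=
  exists c s1 s2 s3, [/\ [/\ path E c s1, path E c s2 & path E c s3],
    uniq (c :: s1 ++ s2 ++ s3),
    [/\ size s1 = size w1, size s2 = size w2 & size s3 = size w3],
    c0 <= f c &
    [/\ forall i, i < size w1 -> nth 0 w1 i <= f (nth c s1 i),
        forall i, i < size w2 -> nth 0 w2 i <= f (nth c s2 i) &
        forall i, i < size w3 -> nth 0 w3 i <= f (nth c s3 i)]].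

Lemma f_gt0r x y : E x y -> 0 < f y.
Proof. by rewrite E_sym; apply: f_gt0. Qed.

Lemma two_others (P : pred V) n :
    (forall y, P y -> f y < n) -> n <= \sum_(y | P y) f y -> 0 < n ->
  exists y1 y2, [/\ P y1, P y2 & y1 != y2].
Proof.
move=> lt_n le_n n_gt0; have [y1 Py1 | P0] := pickP P; last first.
  by move: le_n; rewrite big_pred0 // leqn0 => /eqP n0; rewrite n0 in n_gt0.
have [y2 /andP[Py2 neq] | P1] := pickP (fun y => P y && (y != y1)).
  by exists y1, y2; rewrite eq_sym.
move: le_n; rewrite (bigD1 y1) //= big_pred0 // addn0.
by rewrite leqNgt lt_n.
Qed.

Section NoCycle.
Hypothesis no_cycle : ~ has_cycle.

Lemma no_chord x p : path E x p -> uniq (x :: p) -> 1 < size p -> ~~ E (last x p) x.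
Proof.
move=> xp p_uniq p_size; apply/negP => Ex; apply: no_cycle.
by exists (x :: p); split=> //=; rewrite rcons_path xp.
Qed.

Lemma no_chord_mem x p y : path E x p -> uniq (x :: p) -> E x y ->
  y \in p -> y = head x p.
Proof.
case: p => // z p xp p_uniq Exy; rewrite inE /=.
case: eqVneq => //= neq_yz y_p; case/splitPr: y_p xp p_uniq => p1 p2 xp p_uniq.
have /negP[] : ~~ E (last x (rcons (z :: p1) y)) x; last by rewrite last_rcons E_sym.
apply: no_chord; last by rewrite size_rcons.
  by move: xp; rewrite -cat_rcons /= cat_path => /and3P[-> ->].
by move: p_uniq; rewrite -cat_rcons -!cat_cons cat_uniq => /and3P[].
Qed.

Lemma last_chord x p y : path E x p -> uniq (x :: p) -> E (last x p) y ->
  y \in x :: p -> y = last x (belast x p).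
Proof.
move=> xp p_uniq Ey y_p.
case/lastP: p xp p_uniq Ey y_p => [|p z] xp p_uniq Ey y_p.
  by move: y_p; rewrite inE => /eqP ->.
rewrite belast_rcons /= last_rcons in Ey *.
have y_rev : y \in rev (x :: p).
  move: y_p; rewrite -rcons_cons mem_rcons inE => /orP[/eqP yz|]; last first.
    by rewrite mem_rev.
  by rewrite yz E_irr in Ey.
have zE : rev (x :: rcons p z) = z :: rev (x :: p) by rewrite -rcons_cons rev_rcons.
rewrite (@no_chord_mem z (rev (x :: p)) y) //; first last.
- by rewrite -zE rev_uniq.
- have := rev_path E x (rcons p z).
  rewrite last_rcons belast_rcons => ->.
  by rewrite (eq_path (e' := E)).
by rewrite -nth0 nth_rev //= subn1 /= (last_nth z).
Qed.

Lemma Dtilde_of_forks x p a1 a2 b1 b2 :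
    path E x p -> uniq (x :: p) -> 0 < size p -> all (fun y => 1 < f y) (x :: p) ->
    [/\ E x a1, E x a2, a1 != a2, a1 \notin p & a2 \notin p] ->
    [/\ E (last x p) b1, E (last x p) b2, b1 != b2, b1 \notin x :: p
      & b2 \notin x :: p] ->
  has_Dtilde.
Proof.
move=> xp p_uniq p_gt0 f_gt1 [Ea1 Ea2 neq_a a1p a2p] [Eb1 Eb2 neq_b b1p b2p].
have out y : E x y -> y \notin p -> y \notin x :: p.
  move=> Ey yp; rewrite inE negb_or yp andbT.
  by apply: contraTneq Ey => ->; rewrite E_irr.
have neq_ab a b : E x a -> a \notin p -> E (last x p) b -> a != b.
  move=> Ea ap Eb; apply: contraTneq Eb => <-.
  apply: (@no_chord a (x :: p)) => //; first by rewrite /= E_sym Ea.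
  by rewrite cons_uniq out.
exists x, p, a1, a2, b1, b2; split=> //.
rewrite -cat_cons cat_uniq p_uniq andTb; apply/andP; split.
  apply/hasPn => u; rewrite !inE => /or4P[] /eqP ->;
    by rewrite -in_cons ?(negPf b1p) ?(negPf b2p) // out.
by rewrite /= !inE !negb_or neq_a neq_b !neq_ab.
Qed.

Section Maximum.
Variable M : nat.
Hypothesis f_le : forall y, f y <= M.
Hypothesis M_gt0 : 0 < M.

(** The ends of a longest path among the vertices where [f] is maximal are
    forks: the weights of their other neighbours are less than [M] and sum up
    to [M]. *)
Lemma Dtilde_of_plateau x0 y0 : E x0 y0 -> f x0 = M -> f y0 = M -> has_Dtilde.
Proof.
move=> E0 fx0 fy0.
pose plateau (xp : V * seq V) := [/\ path E xp.1 xp.2, uniq (xp.1 :: xp.2),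
  all (fun y => f y == M) (xp.1 :: xp.2) & 0 < size xp.2].
have plateau0 : plateau (x0, [:: y0]).
  split; rewrite //= ?E0 ?fx0 ?fy0 ?eqxx // inE andbT.
  by apply: contraTneq E0 => ->; rewrite E_irr.
have [[x p] [xpP xp_max]] := @ex_min_measure _ plateau (fun xp => #|V| - size xp.2)
  (ex_intro _ _ plateau0).
have {xp_max} longest y q : plateau (y, q) -> size q <= size p.
  move=> yqP; have /= := xp_max _ yqP.
  have [_ /card_uniqP q_uniq _ _] := yqP; have := max_card (mem (y :: q)).
  have [_ /card_uniqP p_uniq _ _] := xpP; have := max_card (mem (x :: p)).
  rewrite p_uniq q_uniq /=; lia.
have fork y q : plateau (y, q) -> size q = size p -> exists b1 b2, 1 < M /\
    [/\ E (last y q) b1, E (last y q) b2, b1 != b2, b1 \notin y :: q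
      & b2 \notin y :: q].
  move=> [yq q_uniq qM q_gt0] q_size; rewrite [_.1]/= [_.2]/= in yq q_uniq qM q_gt0.
  set z := last y q; set z' := last y (belast y q).
  have fE u : u \in y :: q -> f u = M by move/(allP qM)/eqP.
  have fz : f z = M by apply: fE; rewrite mem_last.
  have Ezz' : E z z'.
    rewrite /z /z'; case/lastP: (q) q_gt0 yq => // r u _.
    by rewrite rcons_path belast_rcons last_rcons E_sym => /andP[].
  have z'_mem : z' \in y :: q.
    rewrite /z'; case/lastP: (q) q_gt0 => // r u _.
    by rewrite belast_rcons /= -rcons_cons mem_rcons inE mem_last orbT.
  have lt_f u : E z u && (u != z') -> f u < M.
    move=> /andP[Ezu neq_uz']; rewrite ltn_neqAle f_le andbT.
    apply/negP => /eqP fu; have [u_q | u_notin] := boolP (u \in y :: q).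
      by case/eqP: neq_uz'; apply: last_chord Ezu u_q.
    suff /longest : plateau (y, rcons q u) by rewrite size_rcons q_size ltnn.
    split; rewrite ?[_.1]/= ?[_.2]/=; first by rewrite rcons_path yq.
    - by rewrite -rcons_cons rcons_uniq u_notin.
    - by rewrite -rcons_cons all_rcons fu eqxx.
    - by rewrite size_rcons.
  have sum_others : M <= \sum_(u | E z u && (u != z')) f u.
    have := f_additive (x := z); rewrite fz => /(_ M_gt0).
    by rewrite (bigD1 z') //= (fE z') // mul2n -addnn => /addnI ->.
  have [b1 [b2 [/andP[Eb1 b1z'] /andP[Eb2 b2z'] neq_b]]] :=
    two_others lt_f sum_others M_gt0.
  have notin u : E z u -> u != z' -> u \notin y :: q.
    move=> Ezu uz'; apply/negP => /fE fu.
    by have := lt_f u; rewrite Ezu uz' fu ltnn => /(_ isT).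
  exists b1, b2; split; last by rewrite !notin.
  by apply: leq_ltn_trans (f_gt0r Eb1) (lt_f b1 _); rewrite Eb1.
have [xp p_uniq pM p_gt0] := xpP; rewrite [_.1]/= [_.2]/= in xp p_uniq pM p_gt0.
have [b1 [b2 [M_gt1 bP]]] := fork x p xpP erefl.
have rev_xp : rev (x :: p) = last x p :: rev (belast x p) by rewrite lastI rev_rcons.
have [||a1 [a2 [_ ]]] := fork (last x p) (rev (belast x p)).
- split; rewrite ?[_.1]/= ?[_.2]/=.
  + by rewrite rev_path (eq_path (e' := E)).
  + by rewrite -rev_xp rev_uniq.
  + by rewrite -rev_xp all_rev.
  + by rewrite size_rev size_belast.
- by rewrite size_rev size_belast.
have -> : last (last x p) (rev (belast x p)) = x.
  by case: (p) p_gt0 => //= u q _; rewrite rev_cons last_rcons.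
rewrite -rev_xp !mem_rev !inE !negb_or => -[Ea1 Ea2 neq_a /andP[_ a1p] /andP[_ a2p]].
apply: (@Dtilde_of_forks x p a1 a2 b1 b2) => //.
by apply/allP => u /(allP pM)/eqP ->.
Qed.

End Maximum.

(** An arm of step [t] from [c]: [f] decreases linearly from [f c] and would
    vanish one step after the end of [s]. *)
Definition arm (c y : V) (t : nat) (s : seq V) : Prop :=
  [/\ path E c s, head c s = y, 0 < size s, f c = (size s).+1 * t
    & forall i, i < size s -> f (nth c s i) + i.+1 * t = f c].

Lemma linear_uniq c t s : 0 < t ->
  (forall i, i < size s -> f (nth c s i) + i.+1 * t = f c) -> uniq (c :: s).
Proof.
move=> t_gt0 s_lin; rewrite /=; apply/andP; split.
  apply/negP => /(nthP c)[i lt_i cE]; have := s_lin i lt_i; rewrite cE => /eqP.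
  by rewrite -{2}[f c]addn0 eqn_add2l muln_eq0 /= gtn_eqF.
apply/(uniqP c) => i j; rewrite !inE => lt_i lt_j eq_ij.
have := s_lin i lt_i; rewrite eq_ij -(s_lin j lt_j) => /addnI/eqP.
by rewrite eqn_pmul2r // eqSS => /eqP.
Qed.

(** While the current end [z] of the arm has exactly one neighbour besides its
    predecessor, additivity continues the linear decrease; two further
    neighbours would make [c] and [z] the branch vertices of a Dtilde graph. *)
Lemma arm_exists c y a1 a2 : ~ has_Dtilde ->
    [/\ E c y, E c a1 & E c a2] -> uniq [:: y; a1; a2] -> f y < f c ->
  exists s, arm c y (f c - f y) s.
Proof.
move=> noD [Ey Ea1 Ea2] neq lt_fy; set t := f c - f y.
have t_gt0 : 0 < t by rewrite subn_gt0.
have fy : f y + t = f c by rewrite subnKC // ltnW.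
suff grow n s : f c - size s <= n -> path E c s -> head c s = y -> 0 < size s ->
    (forall i, i < size s -> f (nth c s i) + i.+1 * t = f c) -> exists s, arm c y t s.
  by apply: (grow _ [:: y] (leqnn _)); rewrite //= ?Ey // => -[] // _; rewrite mul1n.
elim: n s => [|n IHn] s le_n cs sy s_gt0 s_lin;
  set z := last c s; (have fz : f z + size s * t = f c
    by have := s_lin (size s).-1; rewrite prednK // nth_last leqnn => /(_ isT));
  have fz_gt0 : 0 < f z.
- rewrite /z; case/lastP: (s) s_gt0 cs => // r u _.
  by rewrite rcons_path last_rcons => /andP[_ /f_gt0r].
- have := leq_pmulr (size s) t_gt0; lia.
- rewrite /z; case/lastP: (s) s_gt0 cs => // r u _.
  by rewrite rcons_path last_rcons => /andP[_ /f_gt0r].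
have [zt | zt] := eqVneq (f z) t.
  by exists s; split=> //; rewrite -fz zt mulSn.
set z' := last c (belast c s).
have Ezz' : E z z'.
  rewrite /z /z'; case/lastP: (s) s_gt0 cs => // r u _.
  by rewrite rcons_path belast_rcons last_rcons E_sym => /andP[].
have fz' : f z' = f z + t.
  rewrite /z'; move: s_gt0 s_lin fz; rewrite /z; case/lastP: (s) => // r u _.
  rewrite belast_rcons /= last_rcons size_rcons => r_lin.
  case/lastP: r r_lin => [|r v] r_lin; first by rewrite mul1n.
  have := r_lin (size r); rewrite !size_rcons nth_rcons size_rcons ltnS leqnn.
  rewrite nth_rcons ltnn eqxx last_rcons leqnSn => /(_ isT) <-.
  by rewrite mulSn addnA => /addIn.
have sum_others : t + \sum_(u | E z u && (u != z')) f u = f z.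
  have := f_additive fz_gt0; rewrite (bigD1 z') //= fz'; lia.
have cs_uniq := linear_uniq t_gt0 s_lin.
have [w /andP[Ezw wz'] | no_w] := pickP (fun u => E z u && (u != z')); last first.
  by move/eqP: zt; rewrite -sum_others big_pred0 // addn0.
have [w2 /andP[/andP[Ezw2 w2z'] neq_w] | only_w] :=
    pickP (fun u => (E z u && (u != z')) && (u != w)).
  case: noD; apply: (@Dtilde_of_forks c s a1 a2 w w2) => //.
  - have fz_gt1 : 1 < f z.
      rewrite -sum_others (bigD1 w) ?Ezw //= (bigD1 w2) ?Ezw2 ?w2z' //=.
      apply: leq_trans (leq_addl _ _); rewrite addnA; apply: leq_trans (leq_addr _ _).
      exact: leq_add (f_gt0r Ezw) (f_gt0r Ezw2).
    have le_fz u : u \in s -> f z <= f u.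
      move=> /(nthP c)[i lt_i <-]; rewrite -(leq_add2r (size s * t)) fz -(s_lin i lt_i).
      by rewrite leq_add2l leq_pmul2r.
    apply/allP => u; rewrite inE => /orP[/eqP ->|/le_fz]; last exact: leq_trans.
    by apply: leq_trans fz_gt1 _; rewrite -fz leq_addr.
  - move: neq; rewrite /= !inE !andbT negb_or => /andP[/andP[ya1 ya2] neq_a].
    have notin a : E c a -> y != a -> a \notin s.
      move=> Ea; apply: contraNN => a_s; apply/eqP; rewrite -sy.
      exact/esym/(no_chord_mem cs).
    by split=> //; apply: notin.
  - have notin u : E z u -> u != z' -> u \notin c :: s.
      by move=> Ezu; apply: contraNN => u_s; apply/eqP; apply: last_chord Ezu u_s.
    by split=> //; [rewrite eq_sym | apply: notin | apply: notin].
have fw : t + f w = f z.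
  by move: sum_others; rewrite (bigD1 w) ?Ezw //= big_pred0 // addn0.
apply: (IHn (rcons s w)).
- by rewrite size_rcons; clear -le_n; lia.
- by rewrite rcons_path cs.
- by case: (s) s_gt0 sy.
- by rewrite size_rcons.
move=> i; rewrite size_rcons nth_rcons ltnS => le_i.
case: ltnP => [/s_lin // | ge_i].
have -> : i = size s by apply/eqP; rewrite eqn_leq le_i.
by rewrite eqxx -fz -fw mulSn addnA [f w + t]addnC.
Qed.

Lemma arm_pred c y t s i : arm c y t s -> i < size s ->
  E (nth c s i) (nth c (c :: s) i) /\ f (nth c (c :: s) i) = f (nth c s i) + t.
Proof.
move=> [cs _ _ _ s_lin] lt_i; split; first by rewrite E_sym; apply: (pathP c cs).
case: i lt_i => [|i] lt_i /=; first by rewrite -(s_lin 0) // mul1n.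
have := s_lin i (ltnW lt_i); rewrite -(s_lin i.+1 lt_i) [i.+2 * t]mulSn addnA.
by move/addIn.
Qed.

(** At a common vertex of two arms the two predecessors carry larger weights,
    so that they coincide by additivity. *)
Lemma arms_disjoint c y y' t t' s s' :
    arm c y t s -> arm c y' t' s' -> y != y' -> 0 < t -> 0 < t' ->
  ~~ has (mem s) s'.
Proof.
move=> armS armS' neq_y t_gt0 t'_gt0.
have off_c u r v i : arm c v u r -> 0 < u -> i < size r -> nth c r i != c.
  move=> [_ _ _ _ r_lin] u_gt0 lt_i; apply/eqP => rc.
  move: (r_lin i lt_i); rewrite rc => /eqP.
  by rewrite -{2}[f c]addn0 eqn_add2l muln_eq0 /= gtn_eqF.
have same_pred i j : i < size s -> j < size s' -> nth c s i = nth c s' j ->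
    nth c (c :: s) i = nth c (c :: s') j.
  move=> lt_i lt_j eq_ij.
  have [Ei fi] := arm_pred armS lt_i; have [Ej fj] := arm_pred armS' lt_j.
  rewrite eq_ij in Ei fi; apply/eqP/negPn/negP => neq.
  have := f_additive (f_gt0 Ej); rewrite (bigD1 _ Ej) /=.
  by rewrite (bigD1 (nth c (c :: s) i)) ?Ei //= fi fj; lia.
apply/hasPn => z /(nthP c)[j lt_j <-]; apply/negP => /(nthP c)[i lt_i].
elim: i j lt_i lt_j => [|i IHi] [|j] lt_i lt_j eq_ij;
  have := same_pred _ _ lt_i lt_j eq_ij; rewrite [LHS]/= [RHS]/= => eq_pred.
- have [_ sy _ _ _] := armS; have [_ sy' _ _ _] := armS'.
  by case/eqP: neq_y; rewrite -sy -sy' -!nth0.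
- by have := off_c _ _ _ _ armS' t'_gt0 (ltnW lt_j); rewrite -eq_pred eqxx.
- by have := off_c _ _ _ _ armS t_gt0 (ltnW lt_i); rewrite eq_pred eqxx.
- exact: (IHi j (ltnW lt_i) (ltnW lt_j) eq_pred).
Qed.

(** With [M = f c], the steps are $t_i = M/(p_i + 1)$ where $p_i$ is the length
    of the arm, and $t_1 + t_2 + t_3 = M$ becomes
    $\sum_i 1/(p_i + 1) = 1$. *)
Lemma star_of_arms c y1 y2 y3 t1 t2 t3 s1 s2 s3 :
    [/\ arm c y1 t1 s1, arm c y2 t2 s2 & arm c y3 t3 s3] ->
    uniq [:: y1; y2; y3] -> [/\ 0 < t1, 0 < t2 & 0 < t3] ->
    t1 + t2 + t3 = f c -> size s3 <= size s2 <= size s1 ->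
  [\/ has_star 3 [:: 2; 1] [:: 2; 1] [:: 2; 1],
      has_star 4 [:: 3; 2; 1] [:: 3; 2; 1] [:: 2]
    | has_star 6 [:: 5; 4; 3; 2; 1] [:: 4; 2] [:: 3]].
Proof.
move=> [arm1 arm2 arm3] /=; rewrite !inE !andbT negb_or => /andP[/andP[n12 n13] n23].
move=> [t1_gt0 t2_gt0 t3_gt0] sum_t sizes.
have [cs1 _ s1_gt0 M1 lin1] := arm1.
have [cs2 _ s2_gt0 M2 lin2] := arm2.
have [cs3 _ s3_gt0 M3 lin3] := arm3.
have star_uniq : uniq (c :: s1 ++ s2 ++ s3).
  have := linear_uniq t1_gt0 lin1; have := linear_uniq t2_gt0 lin2.
  have := linear_uniq t3_gt0 lin3; rewrite /= => /andP[c3 u3] /andP[c2 u2] /andP[c1 u1].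
  rewrite !cat_uniq !mem_cat !negb_or c1 c2 c3 u1 u2 u3 has_cat negb_or.
  rewrite (arms_disjoint arm1 arm2) // (arms_disjoint arm1 arm3) //.
  by rewrite (arms_disjoint arm2 arm3).
have star c0 w1 w2 w3 : c0 <= f c ->
    [/\ size s1 = size w1, size s2 = size w2 & size s3 = size w3] ->
    [/\ forall i, i < size w1 -> nth 0 w1 i + i.+1 * t1 <= f c,
        forall i, i < size w2 -> nth 0 w2 i + i.+1 * t2 <= f c &
        forall i, i < size w3 -> nth 0 w3 i + i.+1 * t3 <= f c] ->
    has_star c0 w1 w2 w3.
  move=> le_c0 [sw1 sw2 sw3] [le1 le2 le3].
  exists c, s1, s2, s3; split=> //; split=> i lt_i.
  - by rewrite -(leq_add2r (i.+1 * t1)) lin1 ?le1 ?sw1.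
  - by rewrite -(leq_add2r (i.+1 * t2)) lin2 ?le2 ?sw2.
  - by rewrite -(leq_add2r (i.+1 * t3)) lin3 ?le3 ?sw3.
have : [\/ [/\ size s1 = 2, size s2 = 2 & size s3 = 2],
          [/\ size s1 = 3, size s2 = 3 & size s3 = 1]
        | [/\ size s1 = 5, size s2 = 2 & size s3 = 1]].
  move: sizes s1_gt0 s2_gt0 s3_gt0 M1 M2 M3.
  move: (size s1) (size s2) (size s3) => p1 p2 p3; rewrite -sum_t.
  move=> /andP[le32 le21] p1_gt0 p2_gt0 p3_gt0 M1 M2 M3.
  have le_t12 : t1 <= t2.
    by rewrite -(leq_pmul2l (ltn0Sn p1)) -M1 M2 leq_mul2r ltnS le21 orbT.
  have le_t23 : t2 <= t3.
    by rewrite -(leq_pmul2l (ltn0Sn p2)) -M2 M3 leq_mul2r ltnS le32 orbT.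
  have le_p3 : p3 < 3 by rewrite -(leq_pmul2r t3_gt0) -M3; lia.
  case: p3 => [//|[|[|//]]] in p3_gt0 le32 M3 le_p3 *.
    have le_p2 : p2 < 4 by rewrite -(leq_pmul2r t2_gt0) -M2; lia.
    case: p2 => [//|[|[|[|//]]]] in p2_gt0 le32 le21 M2 le_p2 *.
    - lia.
    - suff -> : p1 = 5 by apply: Or33.
      by apply/eqP; rewrite -eqSS -(eqn_pmul2r t1_gt0) -M1; lia.
    - suff -> : p1 = 3 by apply: Or32.
      by apply/eqP; rewrite -eqSS -(eqn_pmul2r t1_gt0) -M1; lia.
  have eq_t12 : t1 = t2 by lia.
  have eq_t23 : t2 = t3 by lia.
  have -> : p1 = 2 by apply/eqP; rewrite -eqSS -(eqn_pmul2r t1_gt0) -M1; lia.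
  have -> : p2 = 2 by apply/eqP; rewrite -eqSS -(eqn_pmul2r t2_gt0) -M2; lia.
  exact: Or31.
case=> -[e1 e2 e3]; rewrite e1 e2 e3 in M1 M2 M3.
- apply: Or31; apply: star; [lia | by rewrite e1 e2 e3 |].
  clear -M1 M2 M3 sum_t t1_gt0 t2_gt0 t3_gt0.
  split; do 2?[case=> [_|] /=; first lia]; by [].
- apply: Or32; apply: star; [lia | by rewrite e1 e2 e3 |].
  clear -M1 M2 M3 sum_t t1_gt0 t2_gt0 t3_gt0.
  split; do 3?[case=> [_|] /=; first lia]; by [].
- apply: Or33; apply: star; [lia | by rewrite e1 e2 e3 |].
  clear -M1 M2 M3 sum_t t1_gt0 t2_gt0 t3_gt0.
  split; do 5?[case=> [_|] /=; first lia]; by [].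
Qed.

End NoCycle.

(** Look at a vertex [c] where [f] is maximal.  If a neighbour attains the
    maximum too, then there is a plateau.  Otherwise the neighbours, whose
    weights add up to [2 * f c], are at least three in number, and exactly
    three unless they form a star of type Dtilde with four leaves. *)
Theorem additive_classification : (exists x, 0 < f x) ->
  [\/ has_cycle, has_Dtilde
    | [\/ has_star 3 [:: 2; 1] [:: 2; 1] [:: 2; 1],
          has_star 4 [:: 3; 2; 1] [:: 3; 2; 1] [:: 2]
        | has_star 6 [:: 5; 4; 3; 2; 1] [:: 4; 2] [:: 3]]].
Proof.
move=> [x0 fx0]; have [|no_cycle] := classic has_cycle; first exact: Or31.
have [|no_D] := classic has_Dtilde; first exact: Or32.
apply: Or33; have [c _ c_max] := @arg_maxnP _ x0 xpredT f isT.
have f_le y : f y <= f c by apply: c_max.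
have fc_gt0 : 0 < f c by apply: leq_trans fx0 (f_le x0).
have lt_f y : E c y -> f y < f c.
  move=> Ey; rewrite ltn_neqAle f_le andbT; apply/negP => /eqP fy.
  exact/no_D/(Dtilde_of_plateau no_cycle f_le fc_gt0 Ey).
have sum_N : \sum_(y <- enum (E c)) f y = 2 * f c.
  by rewrite -(f_additive fc_gt0) big_enum.
have N_mem y : y \in enum (E c) -> E c y by rewrite mem_enum.
move: (enum (E c)) (enum_uniq (E c)) N_mem sum_N => N N_uniq N_mem.
have {}lt_f y : y \in N -> f y < f c by move/N_mem/lt_f.
case: N => [|y1 [|y2 [|y3 [|y4 N]]]] in N_uniq N_mem lt_f *.
- by rewrite big_nil; lia.
- by rewrite big_seq1; have := lt_f y1 (mem_head _ _); lia.
- rewrite !big_cons big_nil; have := lt_f y1; have := lt_f y2.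
  by rewrite !inE !eqxx orbT => /(_ isT) ? /(_ isT) ?; lia.
- rewrite !big_cons big_nil => sum_f.
  have [E1 E2 E3] : [/\ E c y1, E c y2 & E c y3].
    by split; apply: N_mem; rewrite !inE eqxx ?orbT.
  have [lt1 lt2 lt3] : [/\ f y1 < f c, f y2 < f c & f y3 < f c].
    by split; apply: lt_f; rewrite !inE eqxx ?orbT.
  have uniq_perm y y' y'' : perm_eq [:: y1; y2; y3] [:: y; y'; y''] ->
      uniq [:: y; y'; y''] by move/perm_uniq => <-.
  have [s1 arm1] : exists s, arm c y1 (f c - f y1) s.
    by apply: (arm_exists no_cycle (a1 := y2) (a2 := y3)).
  have [s2 arm2] : exists s, arm c y2 (f c - f y2) s.
    apply: (arm_exists no_cycle (a1 := y1) (a2 := y3)) => //; apply: uniq_perm.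
    by apply/permP => P /=; lia.
  have [s3 arm3] : exists s, arm c y3 (f c - f y3) s.
    apply: (arm_exists no_cycle (a1 := y1) (a2 := y2)) => //; apply: uniq_perm.
    by apply/permP => P /=; lia.
  have sorted_star i j k si sj sk : [/\ arm c i (f c - f i) si,
      arm c j (f c - f j) sj & arm c k (f c - f k) sk] ->
      perm_eq [:: y1; y2; y3] [:: i; j; k] -> size sk <= size sj <= size si ->
      [\/ has_star 3 [:: 2; 1] [:: 2; 1] [:: 2; 1],
          has_star 4 [:: 3; 2; 1] [:: 3; 2; 1] [:: 2]
        | has_star 6 [:: 5; 4; 3; 2; 1] [:: 4; 2] [:: 3]].
    move=> arms perm_y; have mem_y := perm_mem perm_y.
    have [lt_i lt_j lt_k] : [/\ f i < f c, f j < f c & f k < f c].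
      by split; apply: lt_f; rewrite mem_y !inE eqxx ?orbT.
    have sum_ijk : \sum_(y <- [:: i; j; k]) f y = 2 * f c.
      by rewrite -(perm_big _ perm_y) /= !big_cons big_nil.
    rewrite !big_cons big_nil in sum_ijk.
    apply: star_of_arms arms _ _ _ => //; first exact: uniq_perm.
      by rewrite !subn_gt0.
    by lia.
  have [le12|/ltnW le21] := leqP (size s1) (size s2);
    have [le13|/ltnW le31] := leqP (size s1) (size s3);
    have [le23|/ltnW le32] := leqP (size s2) (size s3).
  + by apply: (sorted_star y3 y2 y1 s3 s2 s1); rewrite ?le12 //;
    apply/permP => P /=; lia.
  + by apply: (sorted_star y2 y3 y1 s2 s3 s1); rewrite ?le13 //;
    apply/permP => P /=; lia.
  + by apply: (sorted_star y1 y3 y2 s1 s3 s2); rewrite ?le23 //;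
    apply/permP => P /=; lia.
  + by apply: (sorted_star y2 y1 y3 s2 s1 s3); rewrite ?le31 //;
    apply/permP => P /=; lia.
  + by apply: (sorted_star y3 y1 y2 s3 s1 s2); rewrite ?le21 //;
    apply/permP => P /=; lia.
  + by apply: (sorted_star y1 y2 y3 s1 s2 s3); rewrite ?le32 //;
    apply/permP => P /=; lia.
  + by apply: (sorted_star y1 y3 y2 s1 s3 s2); rewrite ?le23 //;
    apply/permP => P /=; lia.
  + by apply: (sorted_star y1 y2 y3 s1 s2 s3); rewrite ?le32 //;
    apply/permP => P /=; lia.
- move=> _; case: no_D; exists c, [::], y1, y2, y3, y4.
  have [E1 E2 E3 E4] : [/\ E c y1, E c y2, E c y3 & E c y4].
    by split; apply: N_mem; rewrite !inE eqxx ?orbT.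
  split=> //=.
    by rewrite andbT; apply: leq_ltn_trans (f_gt0r E1) (lt_f _ (mem_head _ _)).
  have neq_c y : E c y -> c != y by apply: contraTneq => <-; rewrite E_irr.
  rewrite !inE !negb_or !neq_c //= !andbT; move: N_uniq; rewrite /= !inE !negb_or.
  by move=> /and4P[/and4P[-> -> -> _] /and3P[-> -> _] /andP[-> _] _].
Qed.

End AdditiveFunction.

(** * Embedding Euclidean graphs *)

Lemma eq_set2 (T : finType) (a b x y : T) :
  ([set a; b] == [set x; y]) = (a == x) && (b == y) || (a == y) && (b == x).
Proof.
apply/eqP/idP => [eq_ab | /orP[] /andP[/eqP -> /eqP ->] //]; last exact: setUC.
have := set21 a b; have := set22 a b; have := set21 x y; have := set22 x y.
rewrite -eq_ab => xa xb; rewrite eq_ab; move: xa xb.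
by rewrite !inE ![x == _]eq_sym ![y == _]eq_sym; do 4!case: eqVneq => //= ?; subst.
Qed.

(** In a rooted tree every edge joins a node [a e] to its parent [b e], which is
    closer to the root. *)
Lemma ranked_ends_inj (G : graph) (a b : edge G -> node G) (r : node G -> nat) :
    (forall e, ends e = [set a e; b e]) -> injective a ->
    (forall e, r (b e) < r (a e)) ->
  injective (@ends G).
Proof.
move=> endsE a_inj lt_r e e'; rewrite !endsE => /eqP; rewrite eq_set2.
case/orP=> /andP[/eqP ae /eqP be]; first exact: a_inj.
by have := lt_r e; have := lt_r e'; rewrite ae be; lia.
Qed.

Lemma cycle_ends_inj n : 1 < n -> injective (@ends (cycle_graph n)).
Proof.
move=> n_gt1 i j /eqP; rewrite eq_set2 => /orP[/andP[/eqP //] |].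
case/andP=> /eqP-> /eqP /(congr1 val) /=; rewrite -addn1 modnDml addn1.
have lt_j := ltn_ord j; have [lt_j2 | ge_j2] := ltnP j.+2 n.+1.
  by rewrite modn_small //; lia.
by rewrite -(subnK ge_j2) modnDr modn_small; lia.
Qed.

Section SimpleEmbedding.
Variables (Q : quiver) (f : dim_vector Q).

(** Adjacency in the support of [f]. *)
Definition adj : rel (vertex Q) := fun x y =>
  [&& 0 < f x, 0 < f y & [exists a, [set src a; tgt a] == [set x; y]]].

Lemma adj_sym : symmetric adj.
Proof. by move=> x y; rewrite /adj andbCA setUC. Qed.

Lemma adj_gt0 x y : adj x y -> 0 < f x.
Proof. by case/and3P. Qed.

(** When no two edges of [G] have the same ends, an arrow can be chosen for each
    edge separately. *)
Lemma simple_embeds (G : graph) (w : node G -> nat) (phi : node G -> vertex Q) :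
    injective phi -> injective (@ends G) ->
    (forall e, exists u v, ends e = [set u; v] /\ adj (phi u) (phi v)) ->
    (forall v, w v <= f (phi v)) ->
  graph_embeds w f.
Proof.
move=> phi_inj ends_inj phiE le_w.
have /fin_all_exists[eta etaE] : forall e, exists a : arrow Q,
    [set src a; tgt a] = phi @: ends e.
  move=> e; have [u [v [-> /and3P[_ _ /existsP[a /eqP aE]]]]] := phiE e.
  by exists a; rewrite imsetU !imset_set1.
exists phi, eta; split=> // e e' eq_eta; apply: ends_inj.
by apply: (imset_inj phi_inj); rewrite -!etaE eq_eta.
Qed.

Lemma cycle_embeds : has_cycle adj ->
  exists T, graph_embeds (euclidean_weight (T:=T)) f.
Proof.
move=> [[|x p] [s_uniq s_size s_cycle]] //; exists (EucA (size p)).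
pose phi (i : 'I_(size p).+1) := nth x (x :: p) i.
have phiE i : adj (phi i) (phi (ordS i)).
  have := pathP x s_cycle i; rewrite size_rcons => /(_ (ltn_ord i)).
  rewrite -rcons_cons nth_rcons ltn_ord -/(phi i).
  congr (adj _ _); rewrite /phi nth_rcons /=.
  have := ltn_ord i; rewrite ltnS leq_eqVlt => /orP[/eqP -> | lt_i].
    by rewrite ltnn eqxx modnn.
  by rewrite lt_i modn_small.
apply: (@simple_embeds (cycle_graph (size p)) _ phi).
- by move=> i j /eqP; rewrite nth_uniq // => /eqP/val_inj.
- exact: cycle_ends_inj.
- by move=> i; exists i, (ordS i).
- by move=> i; apply: adj_gt0 (phiE i).
Qed.

Lemma Dtilde_embeds : has_Dtilde adj f ->
  exists T, graph_embeds (euclidean_weight (T:=T)) f.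
Proof.
move=> [x [p [a1 [a2 [b1 [b2 [xp f_gt1 s_uniq [Ea1 Ea2] [Eb1 Eb2]]]]]]]].
pose m := size p; exists (EucD m).
pose idx (v : 'I_m.+1 + bool * bool) : nat :=
  match v with inl i => i | inr u => m.+1 + (2 * u.1 + u.2) end.
pose s := (x :: p) ++ [:: a1; a2; b1; b2]; pose phi v := nth x s (idx v).
have phi_path (i : 'I_m.+1) : phi (inl i) = nth x (x :: p) i.
  by rewrite /phi nth_cat ltn_ord.
have phi_leaf u : phi (inr u)
    = if u.1 then (if u.2 then b2 else b1) else (if u.2 then a2 else a1).
  rewrite /phi nth_cat /= ltnNge leq_addr /= addKn.
  by case: u => -[] [].
have leafE u : adj (phi (inr u)) (phi (inl (if u.1 then ord_max else ord0))).
  rewrite phi_leaf phi_path adj_sym; case: u => -[] [] /=;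
  by rewrite ?nth_last //= -?last_nth // ; rewrite /m; case: (p) Eb1 Eb2.
apply: (@simple_embeds (Dtilde_graph m) _ phi).
- have lt_idx v : idx v < size s.
    rewrite size_cat /= -/m; case: v => [i|[u1 u2]] /=; last first.
      by clear; case: u1; case: u2; lia.
    by rewrite (leq_trans (ltn_ord i)) // leq_addr.
  move=> u v /eqP; rewrite nth_uniq ?lt_idx // => /eqP.
  case: u v => [i|[u1 u2]] [j|[v1 v2]] /=.
  + by move/val_inj ->.
  + by have := ltn_ord i; clear; lia.
  + by have := ltn_ord j; clear; lia.
  + by clear; case: u1 u2 v1 v2 => [] [] [] [] //=; lia.
- apply: (@ranked_ends_inj (Dtilde_graph m)
    (fun e => match e with inl i => inl (lift ord0 i) | inr u => inr u end)
    (fun e => match e with inl i => inl (widen_ord (leqnSn m) i)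
      | inr u => inl (if u.1 then ord_max else ord0) end)
    (fun v => match v with inl i => i : nat | inr _ => m.+2 end)).
  + by case=> // i; rewrite setUC.
  + move=> [i|u] [j|v] //; last by case=> ->.
    by move=> /(congr1 idx) /= /eqP; rewrite eqn_add2l => /eqP/val_inj ->.
  + by move=> [i|[[] u]] //=; rewrite ?ltnS // /bump.
- move=> [i|u]; last by exists (inr u), (inl (if u.1 then ord_max else ord0)).
  exists (inl (widen_ord (leqnSn m) i)), (inl (lift ord0 i)); split=> //.
  rewrite !phi_path /=; exact: (pathP x xp).
- move=> [i|u] /=; last by apply: adj_gt0 (leafE u).
  rewrite phi_path; apply: (allP f_gt1); exact: mem_nth.
Qed.

Definition star_map p q r (c : vertex Q) s1 s2 s3 (v : node (star_graph p q r)) :=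
  match v with
  | None => c
  | Some (inl (inl i)) => nth c s1 i
  | Some (inl (inr i)) => nth c s2 i
  | Some (inr i) => nth c s3 i
  end.

Lemma star_map_inward p q r c s1 s2 s3 (v : 'I_p + 'I_q + 'I_r) :
  star_map c s1 s2 s3 (star_inward v) = match v with
    | inl (inl i) => nth c (c :: s1) i
    | inl (inr i) => nth c (c :: s2) i
    | inr i => nth c (c :: s3) i
    end.
Proof.
by case: v => [[i|i]|i]; rewrite /star_inward; case: eqVneq => i0;
  rewrite /star_map ?ord_pred_val //; move: i0; rewrite -[val i]/(nat_of_ord i);
  by [move=> -> | case: (nat_of_ord i)].
Qed.

Lemma star_embeds p q r c0 w1 w2 w3 :
    has_star adj f c0 w1 w2 w3 -> [/\ size w1 = p, size w2 = q & size w3 = r] ->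
  graph_embeds (@star_weight p q r c0 w1 w2 w3) f.
Proof.
move=> [c [s1 [s2 [s3 [[cs1 cs2 cs3] s_uniq [ss1 ss2 ss3] le_c0 [le1 le2 le3]]]]]].
move=> [sw1 sw2 sw3]; rewrite sw1 sw2 sw3 in ss1 ss2 ss3 le1 le2 le3.
pose phi := @star_map p q r c s1 s2 s3.
pose idx (v : node (star_graph p q r)) : nat := match v with
  | None => 0
  | Some (inl (inl i)) => i.+1
  | Some (inl (inr i)) => (p + i).+1
  | Some (inr i) => (p + (q + i)).+1
  end.
have phi_idx v : phi v = nth c (c :: s1 ++ s2 ++ s3) (idx v).
  case: v => [[[i|i]|i]|] //=; rewrite !nth_cat ss1 ?ss2 ?ltn_ord //.
    by rewrite ltnNge leq_addr addKn ltn_ord.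
  by rewrite ltnNge leq_addr addKn ltnNge leq_addr addKn.
have lt_idx v : idx v < size (c :: s1 ++ s2 ++ s3).
  rewrite /= !size_cat ss1 ss2 ss3 ltnS.
  by case: v => [[[i|i]|i]|] //=; have := ltn_ord i; lia.
have edgeE e : adj (phi (Some e)) (phi (star_inward e)).
  rewrite /phi star_map_inward adj_sym.
  case: e => [[i|i]|i]; apply/pathP => //; by rewrite ?ss1 ?ss2 ?ss3.
apply: (@simple_embeds (star_graph p q r) _ phi).
- move=> u v; rewrite !phi_idx => /eqP; rewrite nth_uniq ?lt_idx // => /eqP.
  case: u v => [[[i|i]|i]|] [[[j|j]|j]|] //= [];
    try by [have := ltn_ord i; lia | have := ltn_ord j; lia].
  + by move/val_inj ->.
  + by move/addnI/val_inj ->.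
  + by move/addnI/addnI/val_inj ->.
- apply: (@ranked_ends_inj (star_graph p q r) Some (@star_inward p q r)
    (fun v => match v with
      | None => 0
      | Some (inl (inl i)) | Some (inl (inr i)) | Some (inr i) => i.+1 end)) => //.
    by move=> e e' [].
  by move=> [[i|i]|i]; rewrite /star_inward; case: eqVneq => // i0;
    rewrite ord_pred_val // prednK // lt0n.
- by move=> e; exists (Some e), (star_inward e).
- move=> [[[i|i]|i]|] //=; [exact: le1 | exact: le2 | exact: le3].
Qed.

End SimpleEmbedding.

(** * Minimal vectors with nonpositive Tits form *)

Lemma loop_embeds (Q : quiver) (d : dim_vector Q) (a : arrow Q) :
  src a = tgt a -> 0 < d (src a) -> graph_embeds (euclidean_weight (T:=EucA 0)) d.
Proof.
move=> loop d_gt0; exists (fun=> src a), (fun=> a); split=> //.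
- by move=> i j _; rewrite !ord1.
- by move=> i j _; rewrite !ord1.
- by move=> i /=; rewrite imsetU !imset_set1 -loop.
Qed.

Lemma double_arrow_embeds (Q : quiver) (d : dim_vector Q) (a b : arrow Q) :
    a != b -> src a != tgt a -> [set src b; tgt b] = [set src a; tgt a] ->
    0 < d (src a) -> 0 < d (tgt a) ->
  graph_embeds (euclidean_weight (T:=EucA 1)) d.
Proof.
move=> neq_ab neq_st eq_ends ds dt.
exists (fun i : 'I_2 => if val i == 0 then src a else tgt a),
  (fun i : 'I_2 => if val i == 0 then a else b); split.
- move=> [[|[|//]] lt_i] [[|[|//]] lt_j] /= eq_ij; apply: val_inj => //=;
  by move/eqP: neq_st; rewrite eq_ij.
- move=> [[|[|//]] lt_i] [[|[|//]] lt_j] /= eq_ij; apply: val_inj => //=;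
  by move/eqP: neq_ab; rewrite eq_ij.
- by move=> [[|[|//]] lt_i] /=; rewrite imsetU !imset_set1 /= ?eq_ends // setUC.
- by move=> [[|[|//]] lt_i] /=.
Qed.

Lemma sum_delta (I : finType) (F : I -> nat) y : \sum_x (y == x) * F x = F y.
Proof.
rewrite (bigD1 y) //= eqxx mul1n big1 ?addn0 // => x.
by rewrite eq_sym => /negPf ->.
Qed.

Section MinimalVector.
Variables (Q : quiver) (f : dim_vector Q).
Hypothesis no_loop : forall a : arrow Q, src a = tgt a -> f (src a) = 0.
Hypothesis no_double : forall a b : arrow Q, a != b ->
  [set src b; tgt b] = [set src a; tgt a] -> f (src a) = 0 \/ f (tgt a) = 0.

Lemma adj_irr : irreflexive (adj f).
Proof.
move=> x; apply/negP => /and3P[fx _ /existsP[a]]; rewrite setUid.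
rewrite -(setUid [set x]) eq_set2 orbb => /andP[/eqP sx /eqP tx].
by move: fx; rewrite -sx no_loop // sx tx.
Qed.

Definition squares (g : dim_vector Q) : nat := \sum_x g x * g x.
Definition arrow_products (g : dim_vector Q) : nat := \sum_a g (tgt a) * g (src a).

Definition neighbour_sum (x : vertex Q) : nat :=
  \sum_a ((tgt a == x) * f (src a) + (src a == x) * f (tgt a)).

(** Without loops and double arrows, each neighbour is counted once. *)
Lemma neighbour_sumE x : 0 < f x -> neighbour_sum x = \sum_(y | adj f x y) f y.
Proof.
move=> fx; pose n y a := (tgt a == x) * (src a == y) + (src a == x) * (tgt a == y).
have -> : neighbour_sum x = \sum_y (\sum_a n y a) * f y.
  under eq_bigr => y _ do rewrite big_distrl /=.
  rewrite exchange_big; apply: eq_bigr => a _; rewrite /n.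
  under eq_bigr => y _ do rewrite mulnDl -!mulnA.
  by rewrite big_split -!big_distrr /= !sum_delta.
rewrite [RHS]big_mkcond; apply: eq_bigr => y _.
have [-> | fy] := posnP (f y); first by rewrite muln0; case: ifP.
have nE a : n y a = ([set src a; tgt a] == [set x; y]).
  rewrite /n eq_set2; have [sa | neq] := eqVneq (src a) (tgt a).
    have := no_loop sa; rewrite -sa.
    case: eqVneq => [-> fx0|_]; first by rewrite fx0 in fx.
    by rewrite !mul0n andbF.
  case: (eqVneq (tgt a) x) => [tx|_]; case: (eqVneq (src a) x) => [sx|_] //=.
  - by rewrite tx sx eqxx in neq.
  - by rewrite mul1n addn0 andbT.
  - by rewrite mul1n add0n andbF orbF.
  - by rewrite andbF.
rewrite /adj fx fy /= (eq_bigr _ (fun a _ => nE a)).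
case: existsP => [[a xa] | no_a]; last first.
  by rewrite big1 // => a _; case: eqP => // xa; case: no_a; exists a; rewrite xa.
rewrite (bigD1 a) //= xa big1 ?mul1n // => b neq_ba.
apply/eqP; rewrite eqb0; apply/negP => /eqP xb.
have := no_double neq_ba; rewrite (eqP xa) xb => /(_ erefl).
move: xb => /eqP; rewrite eq_set2.
by case/orP=> /andP[/eqP -> /eqP ->] []; lia.
Qed.

Lemma sum_neighbour_sum : \sum_x f x * neighbour_sum x = 2 * arrow_products f.
Proof.
under eq_bigr => x _ do rewrite big_distrr /=.
rewrite exchange_big /= [in RHS]/arrow_products big_distrr /=.
apply: eq_bigr => a _; under eq_bigr => x _ do rewrite mulnDr !(mulnCA (f x)).
rewrite big_split /= !sum_delta; lia.
Qed.

(** In the absence of a loop at [x], no product decreases in both factors. *)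
Lemma decrease_at x (g := fun y => f y - (y == x)) : 0 < f x ->
  squares f + 1 = squares g + 2 * f x /\
  arrow_products f = arrow_products g + neighbour_sum x.
Proof.
move=> fx; split.
  rewrite /squares (bigD1 x) //= [in RHS](bigD1 x) //= /g eqxx /=.
  have -> : \sum_(y | y != x) (f y - (y == x)) * (f y - (y == x))
      = \sum_(y | y != x) f y * f y.
    by apply: eq_bigr => y /negPf ->; rewrite subn0.
  by case: (f x) fx => // n _; rewrite subn1 /=; lia.
rewrite -big_split; apply: eq_bigr => a _; rewrite /g.
have [tx | _] := eqVneq (tgt a) x; have [sx | _] := eqVneq (src a) x => /=.
- by have := no_loop (etrans sx (esym tx)); rewrite sx => fx0; rewrite fx0 in fx.
- by rewrite tx; case: (f x) fx => // n _; lia.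
- by rewrite sx; case: (f x) fx => // n _; lia.
- by rewrite !subn0; lia.
Qed.

Hypothesis q_nonpos : ~~ tits_pos f.
Hypothesis f_min : forall g : dim_vector Q, (forall x, g x <= f x) ->
  \sum_x g x < \sum_x f x -> (exists x, 0 < g x) -> tits_pos g.

(** Let $q$ be the Tits form and [r = - q(f)].  Minimality of [f] gives
    $\sum_{y \sim x} f_y \ge 2 f_x + r$ on the support; multiplying with $f_x$
    and summing up gives $r \sum_x f_x \le 2r$.  If [r] were positive, then
    $\sum_x f_x \le 2$, which leaves too little for the neighbours of any
    vertex.  So [r = 0], and the inequalities add up to an equality. *)
Lemma minimal_additive x : 0 < f x -> \sum_(y | adj f x y) f y = 2 * f x.
Proof.
move: x; have le_q : squares f <= arrow_products f by rewrite leqNgt.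
pose r := arrow_products f - squares f.
have ineq x : 0 < f x -> 2 * f x + r <= neighbour_sum x.
  move=> fx; have [sqE prodE] := decrease_at fx.
  set g := (fun y => f y - (y == x)) in sqE prodE.
  have [g_gt0 | g0] := classic (exists y, 0 < g y).
    have : tits_pos g.
      apply: f_min g_gt0 => [y|]; first exact: leq_subr.
      rewrite (bigD1 x) //= [X in _ < X](bigD1 x) //= -addSn leq_add //.
        by rewrite /g eqxx subn1 prednK.
      by apply: leq_sum => y _; apply: leq_subr.
    rewrite /tits_pos -/(squares g) -/(arrow_products g); rewrite /r; lia.
  have g0' y : g y = 0.
    by apply/eqP/negPn; rewrite -lt0n; apply/negP => gy; apply: g0; exists y.
  have sq_g : squares g = 0 by rewrite /squares big1 // => y _; rewrite g0'.
  have prod_f : arrow_products f = 0.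
    rewrite /arrow_products big1 // => a _; have [sa | neq] := eqVneq (src a) (tgt a).
      by rewrite no_loop // muln0.
    have := g0' (src a); have := g0' (tgt a); rewrite /g.
    have [sx | _] := eqVneq (src a) x; last by rewrite subn0 => _ ->; rewrite muln0.
    by rewrite -sx eq_sym (negPf neq) subn0 => ->.
  lia.
have ineq_sum x : f x * (2 * f x + r) <= f x * neighbour_sum x.
  by have [-> // | fx] := posnP (f x); rewrite leq_pmul2l // ineq.
have total : \sum_x f x * (2 * f x + r) = 2 * squares f + r * \sum_x f x.
  rewrite /squares !big_distrr -big_split; apply: eq_bigr => x _ /=; lia.
have r_le : r * \sum_x f x <= 2 * r.
  have := leq_sum (index_enum (vertex Q)) (P := xpredT) (fun x _ => ineq_sum x).
  rewrite total sum_neighbour_sum /r; lia.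
have r0 : r = 0.
  apply/eqP; rewrite -leqn0 leqNgt; apply/negP => r_gt0.
  have f_le2 : \sum_x f x <= 2 by rewrite -(leq_pmul2l r_gt0) [r * 2]mulnC.
  have [x fx] : exists x, 0 < f x.
    apply: NNPP => f0; have prod0 : arrow_products f = 0.
      rewrite /arrow_products big1 // => a _.
      by have [-> //|fa] := posnP (f (tgt a)); case: f0; exists (tgt a).
    by rewrite /r prod0 in r_gt0.
  have := ineq x fx; rewrite neighbour_sumE // => le_nbr.
  have : \sum_(y | adj f x y) f y <= \sum_(y | y != x) f y.
    rewrite [X in _ <= X](bigID (adj f x)) /=.
    rewrite (eq_bigl (fun y => (y != x) && adj f x y)) ?leq_addr // => y.
    by case: eqVneq => // ->; rewrite adj_irr.
  by move: f_le2; rewrite (bigD1 x) //=; lia.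
move=> x fx; rewrite -neighbour_sumE //.
have /eqP : f x * (2 * f x + r) = f x * neighbour_sum x.
  apply: (leq_sum_eq ineq_sum); rewrite total sum_neighbour_sum r0 mul0n addn0.
  by rewrite leq_pmul2l // -subn_eq0 -/r r0.
by rewrite eqn_pmul2l // r0 addn0 => /eqP.
Qed.

End MinimalVector.

Lemma graph_embedsW (G : graph) (w : node G -> nat) (Q : quiver) (f d : dim_vector Q) :
  (forall x, f x <= d x) -> graph_embeds w f -> graph_embeds w d.
Proof.
move=> le_fd [phi [eta [phi_inj eta_inj endsE le_w]]]; exists phi, eta; split=> // v.
exact: leq_trans (le_w v) (le_fd _).
Qed.

Theorem tits_nonpos_embeds (Q : quiver) (d : dim_vector Q) :
  ~ weakly_positive d -> exists T, graph_embeds (euclidean_weight (T:=T)) d.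
Proof.
move=> not_pos.
pose bad (f : dim_vector Q) :=
  [/\ forall x, f x <= d x, exists x, 0 < f x & ~~ tits_pos f].
have [f0 bad_f0] : exists f, bad f.
  apply: NNPP => no_bad; apply: not_pos => f le_f f_neq0.
  by apply/negPn/negP => qf; apply: no_bad; exists f.
have [f [[le_fd f_neq0 q_nonpos] f_min]] :=
  ex_min_measure (fun f : dim_vector Q => \sum_x f x) (ex_intro bad f0 bad_f0).
suff [T Tf] : exists T, graph_embeds (euclidean_weight (T:=T)) f.
  by exists T; apply: graph_embedsW Tf.
have [[a [loop fa]] | no_loop] :=
    classic (exists a : arrow Q, src a = tgt a /\ 0 < f (src a)).
  by exists (EucA 0); apply: loop_embeds fa.
have {}no_loop a : src a = tgt a -> f (src a) = 0.
  move=> loop; apply/eqP; rewrite -leqn0 leqNgt; apply/negP => fa.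
  by apply: no_loop; exists a.
have [[a [b [neq_ab eq_ends fs ft]]] | no_double] := classic (exists a b : arrow Q,
    [/\ a != b, [set src b; tgt b] = [set src a; tgt a], 0 < f (src a)
      & 0 < f (tgt a)]).
  exists (EucA 1); apply: (double_arrow_embeds neq_ab _ eq_ends fs ft).
  by apply/eqP => /no_loop fa0; rewrite fa0 in fs.
have {}no_double a b : a != b -> [set src b; tgt b] = [set src a; tgt a] ->
    f (src a) = 0 \/ f (tgt a) = 0.
  move=> neq_ab eq_ends; have [|fs] := posnP (f (src a)); first by left.
  by have [|ft] := posnP (f (tgt a)); [right | case: no_double; exists a, b].
have f_additive := minimal_additive no_loop no_double q_nonpos.
have {}f_additive x : 0 < f x -> \sum_(y | adj f x y) f y = 2 * f x.
  apply: f_additive => g le_gf lt_gf g_neq0.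
  apply/negPn/negP => qg; have := f_min g; rewrite leqNgt lt_gf => /(_ _)/negP[] //.
  by split=> // y; apply: leq_trans (le_gf y) (le_fd y).
have [cyc | Dt | ] := additive_classification (@adj_sym _ f) (adj_irr no_loop)
    (@adj_gt0 _ f) f_additive f_neq0.
- exact: cycle_embeds.
- exact: Dtilde_embeds.
case=> star.
- by exists EucE6; apply: star_embeds star _.
- by exists EucE7; apply: star_embeds star _.
- by exists EucE8; apply: star_embeds star _.
Qed.

Theorem theorem1 (k : closedFieldType) (Q : quiver) (d : dim_vector Q) :
  (representation_infinite k d <->
     exists (Q' : quiver) (E : euclidean Q'),
       setting_le (euclidean_vector E) d) /\
  (representation_infinite k d <->
     exists (S : subquiver Q) (E : euclidean S),
       forall x : vertex S, euclidean_vector E x <= restrict_dim d x).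
Proof.
have infinite (Q' : quiver) (E : euclidean Q') :
    setting_le (euclidean_vector E) d -> representation_infinite k d.
  move=> [psi [psi_inj le_h]] /(representation_finite_le psi_inj le_h).
  exact: tits_nonpos_infinite (euclidean_vector_neq0 E) (euclidean_vector_tits E).
have subquiver_of : representation_infinite k d ->
    exists (S : subquiver Q) (E : euclidean S),
    forall x : vertex S, euclidean_vector E x <= restrict_dim d x.
  move=> inf_d; have [T /embeds_subquiver //] : exists T,
      graph_embeds (euclidean_weight (T:=T)) d.
  by apply: tits_nonpos_embeds => /(@weakly_positive_finite k).
split; split.
- move=> /subquiver_of[S [E le_h]]; exists S, E; exact: subquiver_setting_le.
- by move=> [Q' [E /infinite]].
- exact: subquiver_of.
- by move=> [S [E /subquiver_setting_le/infinite]].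
Qed.
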